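(* Let $p,q,r$ be non-negative integers, let $m,n$ be positive integers, and let $g$ be a non-negative integer with $p+q+r=2g-2+m+n$ and $(g,n+m)\neq(0,2)$. Let $\mathfrak{c}$ be a chamber of the hyperplane arrangement $\mathcal{W}(m,n)$. Then there exists a polynomial $P_{p,q,r}^{\mathfrak{c};(2),\le,<}$ of degree $4g-3+m+n$ in $m+n$ variables such that $$h^{(2),\le,<}_{p,q,r;\mu,\nu}=P_{p,q,r}^{\mathfrak{c};(2),\le,<}(\mu,\nu)$$ for all $(\mu,\nu)\in\mathfrak{c}$, where $h^{(2),\le,<}_{p,q,r;\mu,\nu}$ is the triply mixed Hurwitz number.
   Context: **Triply mixed Hurwitz numbers.** An ordered partition is a finite tuple of positive integers. Let $\mu=(\mu_1,\dots,\mu_m)$, $\nu=(\nu_1,\dots,\nu_n)$ be ordered partitions of the same integer $d$, and let $b=p+q+r=2g-2+m+n$. A triply mixed factorisation of type $(g,\mu,\nu,p,q,r)$ is a tuple $(\sigma_1,\tau_1,\dots,\tau_b,\sigma_2)$ of elements of $S_d$ with $\sigma_2\tau_b\cdots\tau_1\sigma_1=\mathrm{id}$, where $\sigma_1$ has cycle type $\mu$, $\sigma_2$ has cycle type $\nu$, every $\tau_i$ is a transposition, the disjoint cycles of $\sigma_1$ (resp. $\sigma_2$) are labelled $1,\dots,m$ (resp. $1,\dots,n$) so that cycle $i$ has length $\mu_i$ (resp. $\nu_i$) (the labellings are part of the data, and no transitivity is required), and, writing $\tau_i=(r_i\ s_i)$ with $r_i>s_i$, one has $s_{i+1}\ge s_i$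 for $i=p+1,\dots,p+q-1$ and $s_{i+1}>s_i$ for $i=p+q+1,\dots,b-1$. Then $h^{(2),\le,<}_{p,q,r;\mu,\nu}$ is $\frac{1}{d!}$ times the number of such factorisations. **Chambers.** $\mathcal{H}(m,n)$ is the set of pairs $(M,N)$ of tuples of positive integers of lengths $m,n$ with $\sum_iM_i=\sum_jN_j$. The walls of $\mathcal{W}(m,n)$ are the loci $\sum_{i\in I}M_i=\sum_{j\in J}N_j$ for $I\subset\{1,\dots,m\}$, $J\subset\{1,\dots,n\}$, with $(I,J)$ not equal to $(\emptyset,\emptyset)$ or $([m],[n])$. A chamber is a non-empty set consisting of all points of $\mathcal{H}(m,n)$ that lie on no wall and on a prescribed side of each wall. *)

(* Defs.v *)
From mathcomp Require Import all_boot all_order all_fingroup all_algebra.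
From mathcomp Require Import mpoly.

Set Implicit Arguments.
Unset Strict Implicit.
Unset Printing Implicit Defensive.

Import GRing.Theory.

(* The cycles of s, fixed points included, are the blocks of [porbits s]. *)
Definition has_cycle_type (d m : nat) (s : 'S_d) (mu : m.-tuple nat) : bool :=
  perm_eq [seq #|C| | C : {set 'I_d} in porbits s] mu.

Definition is_cycle_labelling (d m : nat) (s : 'S_d) (mu : m.-tuple nat)
    (l : {ffun 'I_m -> {set 'I_d}}) : bool :=
  [&& injectiveb l, [set l i | i : 'I_m] == porbits s
    & [forall i, #|l i| == tnth mu i]].

(* The indices of [tau] start at 0, so the weakly monotone block is
   p, ..., p + q - 1 and the strictly monotone one is p + q, ..., b - 1. *)
Definition mixed_monotone (d p q r : nat)
    (tau : {ffun 'I_(p + q + r) -> 'S_d}) : bool :=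
  [exists x : {ffun 'I_(p + q + r) -> 'I_d},
   exists y : {ffun 'I_(p + q + r) -> 'I_d},
    [&& [forall i, (y i < x i) && (tau i == tperm (x i) (y i))],
        [forall i : 'I_(p + q + r), forall j : 'I_(p + q + r),
           [&& j == i.+1 :> nat, p <= i & j < p + q] ==> (y i <= y j)]
      & [forall i : 'I_(p + q + r), forall j : 'I_(p + q + r),
           ((j == i.+1 :> nat) && (p + q <= i)) ==> (y i < y j)]]].

(* The product of permutations in the library composes from left to right:
   (s * t) x = t (s x). *)
Definition is_mixed_factorisation (d m n p q r : nat)
    (mu : m.-tuple nat) (nu : n.-tuple nat)
    (s1 : 'S_d) (l1 : {ffun 'I_m -> {set 'I_d}})
    (tau : {ffun 'I_(p + q + r) -> 'S_d})
    (s2 : 'S_d) (l2 : {ffun 'I_n -> {set 'I_d}}) : bool :=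
  [&& (s1 * (\prod_(i < p + q + r) tau i) * s2 == 1)%g,
      has_cycle_type s1 mu, has_cycle_type s2 nu,
      is_cycle_labelling s1 mu l1, is_cycle_labelling s2 nu l2
    & mixed_monotone tau].

Definition mixed_factorisations (d m n p q r : nat)
    (mu : m.-tuple nat) (nu : n.-tuple nat) :
    {set 'S_d * {ffun 'I_m -> {set 'I_d}} * {ffun 'I_(p + q + r) -> 'S_d} *
         'S_d * {ffun 'I_n -> {set 'I_d}}} :=
  [set f | let: (s1, l1, tau, s2, l2) := f in
           is_mixed_factorisation mu nu s1 l1 tau s2 l2].

Definition tsum (m : nat) (M : m.-tuple nat) : nat := \sum_(i < m) tnth M i.

Definition triply_mixed_hurwitz (m n p q r : nat)
    (mu : m.-tuple nat) (nu : n.-tuple nat) : rat :=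
  (#|mixed_factorisations (tsum mu) p q r mu nu|%:R / (tsum mu)`!%:R)%R.

Definition in_H (m n : nat) (M : m.-tuple nat) (N : n.-tuple nat) : Prop :=
  [/\ forall i, 0 < tnth M i, forall j, 0 < tnth N j & tsum M = tsum N].

Definition is_wall_index (m n : nat) (I : {set 'I_m}) (J : {set 'I_n}) : Prop :=
  (I, J) <> (set0, set0) /\ (I, J) <> (setT, setT).

(* The side is strict, so the point is not on the wall. *)
Definition on_side (m n : nat) (M : m.-tuple nat) (N : n.-tuple nat)
    (I : {set 'I_m}) (J : {set 'I_n}) (e : bool) : Prop :=
  if e then \sum_(j in J) tnth N j < \sum_(i in I) tnth M i
  else \sum_(i in I) tnth M i < \sum_(j in J) tnth N j.

Definition is_chamber (m n : nat)
    (c : m.-tuple nat -> n.-tuple nat -> Prop) : Prop :=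
  (exists M N, c M N) /\
  exists side : {set 'I_m} -> {set 'I_n} -> bool,
    forall M N, c M N <->
      in_H M N /\
      forall I J, is_wall_index I J -> on_side M N I J (side I J).

(* Main.v *)
Require Import Defs.
From mathcomp Require Import all_boot all_order all_fingroup all_algebra.
From mathcomp Require Import mpoly zify ring.

Set Implicit Arguments.
Unset Strict Implicit.
Unset Printing Implicit Defensive.

Import Order.TTheory GRing.Theory Num.Theory.

(** Summing over monotone blocks of transpositions multiplies by symmetric
    polynomials in the Jucys-Murphy elements of the symmetric group.  By Jucys,
    the strictly monotone block of length r is the sum of all permutations with
    d - r cycles, and the weakly monotone blocks h_q are signed sums of products
    of these, because sum_i (-1)^i e_i h_(q-i) = 0 holds even for noncommuting
    variables taken in opposite orders.  So one may replace the transpositions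
    by a tuple of permutations pi_1, ..., pi_k with d - r_j cycles, where the r_j
    sum to b = p + q + r.

    Only the N <= 2b points moved by some pi_j matter.  Inside a chamber each
    cycle of sigma_1 and of sigma_2 contains such a point, for otherwise the two
    permutations share a cycle and the point lies on a wall.  Recording the
    return map to these N points (finitely many choices, independent of d) and
    the N return times, a factorisation becomes a positive integral flow on a
    bipartite graph with m + n vertices and N edges, whose vertex sums are mu and
    nu; each choice of a return map and a flow accounts for d! / N! factorisations.

    Adding the edges one at a time writes the number of flows as a sum of
    polynomials restricted to cones spanned by independent edges.  The facets of
    such a cone are cuts of the graph, hence walls, so on a chamber the number is
    polynomial, of degree at most N - (m + n - 1) <= 4g - 3 + m + n.  A multiple
    of sum mu - sum nu, which vanishes on the chamber, makes the degree exact. *)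

(** * Elementary symmetric polynomials in the Jucys-Murphy elements *)

(** Whether transpositions form a monotone tuple depends on the order of the points, so monotone
    tuples cannot be grouped by the isomorphism type of their action on the points they move. Having
    a given number of cycles is invariant under conjugation; hence, after the passage to tuples of
    permutations, all supports of the same size N contribute alike. The expansions used there do not
    depend on d.

    The constants: a permutation with d - r cycles moves at most 2r points, so N <= 2b, and 2b - (m
    + n - 1) = 4g - 3 + m + n. Marking needs b > 0; b = 0 occurs only for g = 0 and m + n = 2, the
    excluded case.

    The delicate point in summing over edges is integrality. Off the walls a cut is a nonzero
    integer, so cut >= 0 and cut >= 1 are equivalent and decided by the chamber, but cut >= 2 is
    not. Every inequality that arises must therefore keep a threshold in {0, 1}, and the tests for
    the ends of an interval are designed for this.

    In degree 0, that is for g = 0 and m + n = 3, no multiple of a linear form can adjust the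
    degree; there the constant is shown to be nonzero by a positive term. *)

Section Sym_sums.
Local Open Scope ring_scope.
Variable T : finType.
Implicit Types (s g : {perm T}) (A : {set T}) (F f : {perm T} -> rat).

Definition ncycles s := #|porbits s|.

Lemma ncycles_le s : (ncycles s <= #|T|)%N.
Proof. exact: leq_imset_card. Qed.

Lemma ncycles1 : ncycles 1%g = #|T|.
Proof.
rewrite /ncycles card_imset // => x y; move/eqP; rewrite eq_porbit_mem.
by rewrite porbit.unlock cycle1 imset_set1 /aperm perm1 inE => /eqP.
Qed.

Lemma ncyclesV s : ncycles s^-1 = ncycles s.
Proof. by rewrite /ncycles porbitsV. Qed.

Lemma porbit_fixed s x : s x = x -> porbit s x = [set x].
Proof.
move=> sx; apply/setP => y; rewrite inE; apply/porbitP/eqP => [[i ->]|->].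
  by elim: i => [|i IH]; rewrite ?expg0 ?perm1 // expgSr permM IH.
by exists 0%N; rewrite expg0 perm1.
Qed.

(** The factor [tperm y z] merges the fixed point [y] of [s] into the cycle of [z]. *)
Lemma ncycles_tperm A s y z : perm_on A s -> y \notin A -> z \in A ->
  (ncycles (tperm y z * s)%g).+1 = ncycles s.
Proof.
move=> sA yA zA; have yz : y != z by apply: contraNneq yA => ->.
have := porbits_mul_tperm s y z; rewrite porbit_sym (porbit_fixed (out_perm sA yA)).
rewrite inE eq_sym yz /= -/(ncycles _) -/(ncycles _); lia.
Qed.

Lemma ncycles_tpermr A s y z : perm_on A s -> y \notin A -> z \in A ->
  (ncycles (s * tperm y z)%g).+1 = ncycles s.
Proof.
move=> sA yA zA; rewrite -ncyclesV invMg tpermV.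
by rewrite (ncycles_tperm (A := A)) ?ncyclesV // perm_onV.
Qed.

(** Coset decomposition of Sym([y |: A]) over Sym([A]): the coset of a permutation is read off from
    the preimage z of [y], and z = [y] gives Sym([A]) itself. *)
Lemma sum_perm_on_setU1 A y F : y \notin A ->
  \sum_(s | perm_on (y |: A) s) F s =
  \sum_(s | perm_on A s) (F s + \sum_(z in A) F (tperm y z * s)%g).
Proof.
move=> yA.
have -> : \sum_(s | perm_on A s) (F s + \sum_(z in A) F (tperm y z * s)%g)
    = \sum_(z in y |: A) \sum_(s | perm_on A s) F (tperm y z * s)%g.
  rewrite exchange_big /=; apply: eq_bigr => s _.
  by rewrite big_setU1 //= tperm1 mul1g.
rewrite (partition_big (fun s : {perm T} => s^-1%g y) (mem (y |: A))) /=; last first.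
  by move=> s sA; rewrite perm_closed ?perm_onV // !inE eqxx.
apply: eq_bigr => z zA; rewrite (reindex_inj (mulgI (tperm y z))) /=.
apply: eq_bigl => s.
have tA : perm_on (y |: A) (tperm y z).
  apply: subset_trans (tperm_on y z) _.
  by apply/subsetP => x; rewrite !inE => /orP[/eqP->|/eqP ->]; [rewrite eqxx | rewrite !inE in zA].
have -> : perm_on (y |: A) (tperm y z * s)%g = perm_on (y |: A) s.
  apply/idP/idP => [h|]; last exact: perm_onM.
  by rewrite -(mulKg (tperm y z) s) tpermV perm_onM.
rewrite invMg permM tpermV.
have -> : (tperm y z ((s^-1)%g y) == z) = (s y == y).
  rewrite -{2}(tpermL y z) (inj_eq perm_inj) -(inj_eq (@perm_inj _ s)) permKV.
  by rewrite eq_sym.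
apply/andP/idP => [[sA /eqP sy]|sA].
  apply/subsetP => x; rewrite inE => sx.
  have := subsetP sA x; rewrite !inE sx => /(_ isT) /orP[/eqP xy|//].
  by rewrite xy sy eqxx in sx.
split; last by rewrite (out_perm sA yA).
by apply: subset_trans sA _; apply: subsetUr.
Qed.

Lemma sum_perm_on_setU1r A y F : y \notin A ->
  \sum_(s | perm_on (y |: A) s) F s =
  \sum_(s | perm_on A s) (F s + \sum_(z in A) F (s * tperm y z)%g).
Proof.
move=> yA; rewrite (reindex_inj invg_inj) /=.
have e B : (fun s => perm_on B (s^-1)%g) =1 @perm_on T B.
  by move=> s; apply/idP/idP => h; [rewrite -(invgK s)|]; apply: perm_onV.
rewrite (eq_bigl _ _ (e _)) sum_perm_on_setU1 // [RHS](reindex_inj invg_inj) /=.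
rewrite [RHS](eq_bigl _ _ (e _)); apply: eq_bigr => s _; congr (_ + _).
by apply: eq_bigr => z _; rewrite invMg tpermV.
Qed.

(* [elem A r] is right multiplication by the r-th elementary symmetric
   polynomial in the Jucys-Murphy elements of Sym A. *)
Definition elem A (r : nat) f g : rat :=
  \sum_(s | perm_on A s && (ncycles s + r == #|T|)%N) f (g * s)%g.

Lemma elemE A r f g : elem A r f g =
  \sum_(s | perm_on A s) (if (ncycles s + r == #|T|)%N then f (g * s)%g else 0).
Proof. by rewrite /elem big_mkcondr. Qed.

Lemma elem_ext A r f f' g : f =1 f' -> elem A r f g = elem A r f' g.
Proof. by move=> e; apply: eq_bigr => s _; rewrite e. Qed.

Lemma elem_sum (I : Type) (w : seq I) (c : I -> rat) (h : I -> {perm T} -> rat) A r g :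
  elem A r (fun x => \sum_(i <- w) c i * h i x) g = \sum_(i <- w) c i * elem A r (h i) g.
Proof.
rewrite /elem exchange_big /=; apply: eq_bigr => i _; by rewrite mulr_sumr.
Qed.

Lemma elemB A r f f' g :
  elem A r (fun x => f x - f' x) g = elem A r f g - elem A r f' g.
Proof. by rewrite /elem -sumrB. Qed.

(** Only the identity has as many cycles as there are points: then [porbit s] is injective, while x
    and s x lie in one cycle. *)
Lemma elem0 A f g : elem A 0 f g = f g.
Proof.
rewrite /elem (bigD1 1%g) /=; last by rewrite perm_on1 ncycles1 addn0 eqxx.
rewrite mulg1 big1 ?addr0 // => s /andP[/andP[_ /eqP h] n1]; case/negP: n1.
apply/eqP/permP => x; rewrite perm1; apply/eqP; rewrite -in_set1.
have inj : injective (porbit s).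
  by apply/injectiveP; rewrite /injectiveb /dinjectiveb;
     apply/card_uniqP; rewrite size_map -cardE -h addn0 /ncycles /porbits /=;
     apply: eq_card => y; apply/mapP/imsetP => -[z _ ->]; exists z; rewrite ?mem_enum.
by rewrite in_set1; apply/eqP/inj; rewrite -{2}(expg1 s) porbit_perm.
Qed.

Lemma elem_set0 r f g : elem set0 r f g = if r is 0 then f g else 0.
Proof.
case: r => [|r]; first exact: elem0.
rewrite /elem big1 // => s /andP[s0]; have -> : s = 1%g.
  by apply/permP => x; rewrite perm1 (out_perm s0) ?inE.
by rewrite ncycles1 => /eqP; lia.
Qed.

(** The recursion e_(r+1)(A, y) = e_(r+1)(A) + J_y e_r(A), with J_y the sum of the [tperm y z], z in
    [A]. Here J_y comes first, in [elemSr] last: the first order unrolls a monotone chain, the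
    second makes the relation between e and h telescope. *)
Lemma elemS A r y f g : y \notin A ->
  elem (y |: A) r.+1 f g =
  elem A r.+1 f g + \sum_(z in A) elem A r f (g * tperm y z)%g.
Proof.
move=> yA; rewrite !elemE sum_perm_on_setU1 // big_split /=; congr (_ + _).
under [in RHS]eq_bigr => z zA do rewrite elemE.
rewrite [RHS]exchange_big /=; apply: eq_bigr => s sA; apply: eq_bigr => z zA.
by rewrite mulgA addnS -addSn (ncycles_tperm sA).
Qed.

Lemma elemSr A r y f g : y \notin A ->
  elem (y |: A) r.+1 f g =
  elem A r.+1 f g + elem A r (fun h => \sum_(z in A) f (h * tperm y z)%g) g.
Proof.
move=> yA; rewrite !elemE sum_perm_on_setU1r // big_split /=; congr (_ + _).
apply: eq_bigr => s sA; case: ifP => h; [apply: eq_bigr|apply: big1] => z zA;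
  by rewrite mulgA addnS -addSn (ncycles_tpermr sA) // h.
Qed.

End Sym_sums.

(** * Complete homogeneous polynomials and monotone chains *)

Section Fcons.
Variables (Z : Type) (n : nat).
Definition fcons (z0 : Z) (z : {ffun 'I_n -> Z}) : {ffun 'I_n.+1 -> Z} :=
  [ffun i => oapp z z0 (unlift ord0 i)].

Lemma fcons0 z0 z : fcons z0 z ord0 = z0.
Proof. by rewrite ffunE unlift_none. Qed.

Lemma fconsS z0 z i : fcons z0 z (lift ord0 i) = z i.
Proof. by rewrite ffunE liftK. Qed.

End Fcons.

Lemma forall_ordS n (Q : pred 'I_n.+1) :
  [forall i, Q i] = Q ord0 && [forall i, Q (lift ord0 i)].
Proof.
apply/forallP/andP => [h|[h0 /forallP h] i]; first by split => //; apply/forallP.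
by case: (unliftP ord0 i) => [j ->|->].
Qed.

Lemma big_fcons (R : Type) (idx : R) (op : Monoid.com_law idx) (Z : finType) n
    (P : pred {ffun 'I_n.+1 -> Z}) (F : {ffun 'I_n.+1 -> Z} -> R) :
  \big[op/idx]_(z | P z) F z =
  \big[op/idx]_(z0 : Z) \big[op/idx]_(z : {ffun 'I_n -> Z} | P (fcons z0 z)) F (fcons z0 z).
Proof.
rewrite (pair_big_dep xpredT (fun z0 z => P (fcons z0 z)) (fun z0 z => F (fcons z0 z))) /=.
apply: (reindex (fun u : Z * {ffun 'I_n -> Z} => fcons u.1 u.2)).
exists (fun z : {ffun _ -> _} => (z ord0, [ffun i : 'I_n => z (lift ord0 i)])) => [[z0 z]|z] _ /=.
  by rewrite fcons0; congr pair; apply/ffunP => i; rewrite ffunE fconsS.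
apply/ffunP => i; case: (unliftP ord0 i) => [j ->|->]; rewrite ?fcons0 // fconsS ffunE //.
Qed.

Section Chain.
Local Open Scope ring_scope.
Variables (gT : finGroupType) (Z : finType) (t : Z -> gT).
Variables (R : nat -> rel Z) (P : pred Z).

(** The position [i] is carried along because the relation between neighbours changes from block to
    block; [c] is the constraint inherited from the preceding link. *)
Fixpoint chain_sum (b i : nat) (c : pred Z) (f : gT -> rat) (g : gT) : rat :=
  if b is b'.+1 then
    \sum_(z | P z && c z) chain_sum b' i.+1 (R i z) f (g * t z)%g
  else f g.

Lemma chain_sumS b i c f g : chain_sum b.+1 i c f g =
  \sum_(z | P z && c z) chain_sum b i.+1 (R i z) f (g * t z)%g.
Proof. by []. Qed.

Definition chained (b i : nat) (c : pred Z) (z : {ffun 'I_b -> Z}) : bool :=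
  [&& [forall j, P (z j)],
      [forall j : 'I_b, forall k : 'I_b, (k == j.+1 :> nat) ==> R (i + j)%N (z j) (z k)]
    & [forall j : 'I_b, (j == 0%N :> nat) ==> c (z j)]].

Lemma chained_fcons b i c z0 (z : {ffun 'I_b -> Z}) :
  chained i c (fcons z0 z) = P z0 && c z0 && chained i.+1 (R i z0) z.
Proof.
rewrite /chained !forall_ordS /= fcons0.
under eq_forallb => j do rewrite fconsS.
under [in X in _ && _ && X]eq_forallb => j do rewrite fconsS /=.
rewrite addn0 /=.
have -> : [forall j : 'I_b, (bump 0 j == 1%N) ==> R i z0 (z j)]
   = [forall j : 'I_b, (j == 0%N :> nat) ==> R i z0 (z j)].
  by [].
have -> : [forall j : 'I_b, forall k : 'I_b.+1,
     (k == (bump 0 j).+1 :> nat) ==> R (i + bump 0 j)%N (fcons z0 z (lift ord0 j)) (fcons z0 z k)]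
   = [forall j : 'I_b, forall k : 'I_b, (k == j.+1 :> nat) ==> R (i.+1 + j)%N (z j) (z k)].
  apply: eq_forallb => j; rewrite forall_ordS /=; apply: eq_forallb => k.
  by rewrite !fconsS; have -> : (i + bump 0 j = i.+1 + j)%N by rewrite /bump /=; lia.
have -> : [forall j : 'I_b, true] = true by apply/forallP.
rewrite andbT; set A := P z0; set B := c z0.
set C := [forall _, _]; set D := [forall _, _]; set E := [forall _, _].
by case: A B C D E => [] [] [] [] [].
Qed.

Lemma chain_sumE b i c f g :
  \sum_(z : {ffun 'I_b -> Z} | chained i c z) f (g * \prod_(j < b) t (z j))%g
  = chain_sum b i c f g.
Proof.
elim: b i c g => [|b IH] i c g.
  rewrite /= (bigD1 [ffun x : 'I_0 => False_rect Z (notF (ltn_ord x))]) /=; last first.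
    by apply/and3P; split; apply/forallP => -[].
  rewrite big_ord0 mulg1 big1 ?addr0 // => z /andP[_ /negP []].
  by apply/eqP/ffunP => -[].
rewrite big_fcons /= [RHS]big_mkcond; apply: eq_bigr => z0 _.
under eq_bigl => z do rewrite chained_fcons.
case: ifP => h /=; last by rewrite big_pred0.
rewrite -IH; apply: eq_bigr => z _.
rewrite big_ord_recl fcons0 mulgA; congr (f (_ * _)%g).
by apply: eq_bigr => j _; rewrite fconsS.
Qed.

End Chain.

Section MonotoneChains.
Local Open Scope ring_scope.
Variable d : nat.
Implicit Types (f : 'S_d -> rat) (g : 'S_d).

(** Monotonicity concerns the smaller entry of a transposition, so the Jucys-Murphy element J_k is
    the sum of the (x k) with x > k, and points are added in decreasing order. *)
Definition tail (k : nat) : {set 'I_d} := [set x : 'I_d | (k <= x)%N].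

Lemma tail_ind (P : nat -> Prop) :
  (forall k, (d <= k)%N -> P k) -> (forall k : 'I_d, P k.+1 -> P k) -> forall k, P k.
Proof.
move=> P0 PS k; have [n] := ubnP (d - k).
elim: n k => // n IH k; case: (ltnP k d) => [kd|dk] h; last exact: P0.
by apply: (PS (Ordinal kd)); apply: IH => /=; lia.
Qed.

Lemma tail_out k : (d <= k)%N -> tail k = set0.
Proof. by move=> dk; apply/setP => x; rewrite !inE; apply/negbTE; have := ltn_ord x; lia. Qed.

Lemma tail0 : tail 0 = setT.
Proof. by apply/setP => x; rewrite !inE. Qed.

Lemma tailS (k : 'I_d) : tail k = k |: tail k.+1.
Proof. by apply/setP => x; rewrite !inE leq_eqVlt eq_sym. Qed.

Lemma notin_tailS (k : 'I_d) : k \notin tail k.+1.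
Proof. by rewrite inE ltnn. Qed.

Definition pair_from (k : nat) : pred ('I_d * 'I_d) :=
  fun z => (z.2 < z.1)%N && (k <= z.2)%N.

Lemma sum_pair_out k (F : 'I_d * 'I_d -> rat) : (d <= k)%N ->
  \sum_(z | pair_from k z) F z = 0.
Proof.
move=> dk; apply: big_pred0 => z; rewrite /pair_from.
by apply/negbTE; rewrite negb_and -!ltnNge (leq_trans (ltn_ord _) dk) orbT.
Qed.

Lemma sum_pairS (k : 'I_d) (F : 'I_d * 'I_d -> rat) :
  \sum_(z | pair_from k z) F z =
  \sum_(z | pair_from k.+1 z) F z + \sum_(x in tail k.+1) F (x, k).
Proof.
rewrite (bigID (fun z => z.2 == k)) /= addrC; congr (_ + _).
  apply: eq_bigl => z; rewrite /pair_from -andbA; congr (_ && _).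
  by rewrite [in RHS]ltn_neqAle eq_sym andbC -val_eqE.
rewrite (reindex_onto (fun x => (x, k)) fst) /=; last by move=> [x y] /= /andP[_ /eqP ->].
by apply: eq_bigl => x; rewrite /pair_from /= inE !eqxx leqnn !andbT.
Qed.

Definition swap (z : 'I_d * 'I_d) : 'S_d := tperm z.1 z.2.

(* [hsum 0 q] is right multiplication by the complete homogeneous polynomial of
   degree q in the Jucys-Murphy elements. *)
Fixpoint hsum (k q : nat) f g : rat :=
  if q is q'.+1 then \sum_(z | pair_from k z) hsum z.2 q' f (g * swap z)%g
  else f g.

Lemma hsum_unfold k q f g :
  hsum k q.+1 f g = \sum_(z | pair_from k z) hsum z.2 q f (g * swap z)%g.
Proof. by []. Qed.

(** A weakly increasing word with letters from k on either avoids k or begins with it. *)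
Lemma hsumS (k : 'I_d) q f g : hsum k q.+1 f g =
  hsum k.+1 q.+1 f g + \sum_(x in tail k.+1) hsum k q f (g * tperm k x)%g.
Proof.
rewrite /= sum_pairS; congr (_ + _); apply: eq_bigr => x _.
by rewrite /swap tpermC.
Qed.

(** One step of Jucys' theorem: iterating it splits the sum of all permutations with a given number
    of cycles into strictly monotone products. *)
Lemma elem_chain k r f g :
  elem (tail k) r.+1 f g = \sum_(z | pair_from k z) elem (tail z.2.+1) r f (g * swap z)%g.
Proof.
elim/tail_ind: k => [k dk|k IH]; first by rewrite tail_out // elem_set0 sum_pair_out.
rewrite tailS elemS ?notin_tailS // IH [RHS]sum_pairS; congr (_ + _).
by apply: eq_bigr => x _; rewrite /swap /= tpermC.
Qed.

(** Let e', h' be the polynomials without J_k. In e_i = e'_i + e'_(i-1) J_k and h_j = h'_j + J_k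
    h_(j-1) the element J_k stands between the two factors, so the alternating sum regroups into the
    terms e'_i (h_(q-i) - J_k h_(q-i-1)) = e'_i h'_(q-i). *)
Lemma elem_hsum k q f g :
  \sum_(i < q.+1) (-1) ^+ i * elem (tail k) i (hsum k (q - i) f) g = f g *+ (q == 0).
Proof.
elim/tail_ind: k => [k dk|k IH].
  rewrite big_ord_recl /= expr0 mul1r elem0 subn0 big1 ?addr0.
    by case: q => [|q] //=; rewrite sum_pair_out.
  by move=> i _; rewrite tail_out // elem_set0 mulr0.
rewrite -IH; case: q {IH} => [|q]; first by rewrite !big_ord1 /= !elem0.
pose A i := elem (tail k.+1) i (hsum k (q.+1 - i) f) g.
pose B i := elem (tail k.+1) i (fun h => \sum_(x in tail k.+1) hsum k (q - i) f (h * tperm k x)%g) g.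
transitivity (\sum_(i < q.+2) (-1) ^+ i * A i - \sum_(i < q.+1) (-1) ^+ i * B i).
  rewrite [LHS]big_ord_recl [X in _ = X - _]big_ord_recl -!addrA; congr (_ + _).
    by rewrite /A /= !elem0.
  rewrite -sumrB; apply: eq_bigr => i _.
  rewrite lift0 tailS elemSr ?notin_tailS // -/(A _) mulrDr exprS subSS -/(B _).
  by rewrite /A subSS; ring.
rewrite [RHS]big_ord_recr [X in X - _]big_ord_recr /= addrAC -sumrB; congr (_ + _).
  apply: eq_bigr => i _; have iq : (q.+1 - i = (q - i).+1)%N by have := ltn_ord i; lia.
  rewrite -mulrBr -elemB; congr (_ * _); apply: elem_ext => h.
  by rewrite iq hsumS addrK.
by rewrite /A subnn.
Qed.

Lemma hsum_rec q f g :
  hsum 0 q.+1 f g = \sum_(i < q.+1) (-1) ^+ i * elem setT i.+1 (hsum 0 (q - i) f) g.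
Proof.
have := elem_hsum 0 q.+1 f g; rewrite tail0 mulr0n big_ord_recl expr0 mul1r elem0 subn0.
move/(canRL (addrK _)); rewrite add0r => ->; rewrite -sumrN.
by apply: eq_bigr => i _; rewrite lift0 exprS subSS mulN1r mulNr opprK.
Qed.

Definition elems (w : seq nat) f : 'S_d -> rat := foldr (fun r h => elem setT r h) f w.

Lemma elems_sum (I : Type) (w : seq I) (c : I -> rat) (h : I -> 'S_d -> rat) v g :
  elems v (fun x => \sum_(i <- w) c i * h i x) g = \sum_(i <- w) c i * elems v (h i) g.
Proof.
elim: v g => //= r v IH g; rewrite -elem_sum; exact: elem_ext.
Qed.

Lemma elems_ext w f f' g : f =1 f' -> elems w f g = elems w f' g.
Proof. by move=> e; elim: w g => //= r w IH g; apply: elem_ext. Qed.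

End MonotoneChains.

(** Unfolding [hsum_rec] gives a signed sum over compositions of q. The list [L] is chosen before
    [d], which lets one polynomial serve all d. *)
Lemma hsum_elems q : exists L : seq (rat * seq nat),
  all (fun cw => (sumn cw.2 == q) && all (leq 1) cw.2) L /\
  forall d (f : 'S_d -> rat) g,
    hsum 0 q f g = (\sum_(cw <- L) cw.1 * elems cw.2 f g)%R.
Proof.
suff [Ls h] : exists Ls : nat -> seq (rat * seq nat), forall j, j <= q ->
   all (fun cw => (sumn cw.2 == j) && all (leq 1) cw.2) (Ls j) /\
   forall d (f : 'S_d -> rat) g,
    hsum 0 j f g = (\sum_(cw <- Ls j) cw.1 * elems cw.2 f g)%R.
  by exists (Ls q); apply: h.
elim: q => [|q [Ls IH]].
  exists (fun _ => [:: (1%R, [::])]) => j; rewrite leqn0 => /eqP ->; split => // d f g.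
  by rewrite big_seq1 mul1r.
pose L := flatten [seq [seq ((-1) ^+ i * cw.1, i.+1 :: cw.2)%R | cw <- Ls (q - i)] | i <- iota 0 q.+1].
exists (fun j => if j == q.+1 then L else Ls j) => j jq; case: eqP => [->|/eqP jn]; last first.
  by apply: IH; lia.
split=> [|d f g].
  apply/allP => cw /flattenP[s /mapP[i ii ->]] /mapP[cw' h ->] /=.
  rewrite mem_iota in ii; have [] := IH (q - i) (leq_subr _ _).
  by move/allP/(_ _ h) => /andP[/eqP -> ->] _; rewrite andbT; apply/eqP; lia.
rewrite hsum_rec big_flatten big_map -(big_mkord xpredT (fun i => (-1) ^+ i * elem setT i.+1 (hsum 0 (q - i) f) g)%R) /=.
rewrite /index_iota subn0; apply: eq_bigr => i _; rewrite big_map /=.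
have [_ e] := IH (q - i) (leq_subr _ _).
rewrite (elem_ext _ _ _ (e d f)) elem_sum mulr_sumr; apply: eq_bigr => cw _.
by rewrite mulrA.
Qed.

(** * Mixed monotone products as elementary symmetric polynomials *)

Section MixedSum.
Local Open Scope ring_scope.
Variables (d p q r : nat).
Implicit Types (f : 'S_d -> rat) (g : 'S_d).

Definition mono_step (i : nat) : rel ('I_d * 'I_d) := fun z z' =>
  ((p <= i) && (i.+1 < p + q) ==> (z.2 <= z'.2))%N && ((p + q <= i) ==> (z.2 < z'.2))%N.

Definition down_pair : pred ('I_d * 'I_d) := fun z => (z.2 < z.1)%N.

Lemma swap_inj : {in down_pair &, injective (@swap d)}.
Proof.
move=> [x y] [x' y'] yx yx' e; rewrite /swap /= in e.
have {}yx : (y < x)%N := yx; have {}yx' : (y' < x')%N := yx'.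
have := tpermL x y; rewrite e.
case: tpermP => [xx yy|xy xx|_ _ xy]; first by rewrite xx yy.
  by move: yx yx'; rewrite xx xy; lia.
by move: yx; rewrite xy ltnn.
Qed.

Lemma mixed_monotone_swap (tau : {ffun 'I_(p + q + r) -> 'S_d}) :
  mixed_monotone tau =
  (tau \in [set [ffun i => swap (z i)] | z : {ffun 'I_(p + q + r) -> 'I_d * 'I_d}
             in [set z | chained mono_step down_pair 0 xpredT z]]).
Proof.
apply/existsP/imsetP => [[x /existsP[y /and3P[/forallP h1 /forallP h2 /forallP h3]]]|[z]].
  exists [ffun i => (x i, y i)]; last first.
    by apply/ffunP => i; rewrite !ffunE; have /andP[_ /eqP] := h1 i.
  rewrite inE; apply/and3P; split; apply/forallP => i.
  - by rewrite ffunE /down_pair /=; have /andP[] := h1 i.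
  - apply/forallP => j; apply/implyP => ij; rewrite !ffunE /mono_step add0n /=.
    have /forallP/(_ j) := h2 i; have /forallP/(_ j) := h3 i; rewrite ij /= => -> /=.
    by rewrite (eqP ij) andbT.
  - by apply/implyP.
rewrite inE => /and3P[/forallP h1 /forallP h2 _] ->{tau}.
exists [ffun i => (z i).1]; apply/existsP; exists [ffun i => (z i).2].
apply/and3P; split; apply/forallP => i.
- by rewrite !ffunE eqxx andbT; apply: h1.
- apply/forallP => j; apply/implyP => /and3P[ij pi jq]; rewrite !ffunE.
  have /forallP/(_ j) := h2 i; rewrite ij /mono_step add0n pi /= -(eqP ij) jq /=.
  by case/andP.
- apply/forallP => j; apply/implyP => /andP[ij pi]; rewrite !ffunE.
  have /forallP/(_ j) := h2 i; rewrite ij /mono_step add0n pi /=.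
  by case/andP.
Qed.

Lemma mixed_sum_chain f :
  \sum_(tau : {ffun 'I_(p + q + r) -> 'S_d} | mixed_monotone tau) f (\prod_i tau i)%g
  = chain_sum (@swap d) mono_step down_pair (p + q + r) 0 xpredT f 1%g.
Proof.
rewrite (eq_bigl _ _ mixed_monotone_swap) big_imset /=; last first.
  move=> z z'; rewrite !inE => /and3P[/forallP h _ _] /and3P[/forallP h' _ _] e.
  apply/ffunP => i; apply: swap_inj; [exact: h|exact: h'|].
  by have /ffunP/(_ i) := e; rewrite !ffunE.
rewrite -chain_sumE; apply: eq_big => [z|z _]; first by rewrite inE.
by rewrite mul1g; congr (f _); apply: eq_bigr => i _; rewrite ffunE.
Qed.

Lemma chain_sum_strict b i k c f g : (p + q <= i)%N ->
  c =1 (fun z : 'I_d * 'I_d => (k <= z.2)%N) ->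
  chain_sum (@swap d) mono_step down_pair b i c f g = elem (tail d k) b f g.
Proof.
move=> pi; elim: b i pi k c g => [|b IH] i pi k c g ck; first by rewrite elem0.
rewrite elem_chain /=; apply: eq_big => [z|z _]; first by rewrite ck.
apply: IH => [|z']; first by rewrite ltnW.
by rewrite /mono_step pi /= -(subnKC pi); case: (_ <= _)%N => /=; lia.
Qed.

Lemma chain_sum_weak b i k c f g : (p <= i)%N -> (i + b.+1 = p + q)%N ->
  c =1 (fun z : 'I_d * 'I_d => (k <= z.2)%N) ->
  chain_sum (@swap d) mono_step down_pair (b.+1 + r) i c f g
  = hsum k b.+1 (elem setT r f) g.
Proof.
elim: b i k c g => [|b IH] i k c g pi e ck.
  rewrite addSn chain_sumS hsum_unfold; apply: eq_big => [z|z _]; first by rewrite ck.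
  (* The last weak link imposes nothing on the first strict one, so the strict block starts from the
     full set of points. *)
  rewrite (@chain_sum_strict _ _ 0%N) ?tail0 //; first lia.
  move=> z'; rewrite /mono_step pi /= (_ : (i.+1 < p + q)%N = false) /=; last lia.
  by rewrite (_ : (p + q <= i)%N = false) //; lia.
rewrite addSn chain_sumS hsum_unfold; apply: eq_big => [z|z _]; first by rewrite ck.
rewrite (IH _ z.2) //; [lia..|].
move=> z'; rewrite /mono_step pi /= (_ : (i.+1 < p + q)%N = true) /=; last lia.
by rewrite (_ : (p + q <= i)%N = false) ?andbT //; lia.
Qed.

(** Each free transposition contributes e_1 of all points. An empty weak block is treated apart
    because [chain_sum_weak] starts from a nonempty one. *)
Lemma chain_sum_free b i c f g : (i + b = p)%N -> c =1 xpredT ->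
  chain_sum (@swap d) mono_step down_pair (b + q + r) i c f g
  = elems (nseq b 1%N) (hsum 0 q (elem setT r f)) g.
Proof.
elim: b i c g => [|b IH] i c g e cT.
  rewrite addn0 in e; rewrite {}e -[elems _ _]/(hsum 0 q (elem setT r f)).
  case: (posnP q) => q0.
    have -> : hsum 0 q (elem setT r f) g = elem setT r f g by rewrite q0.
    have -> : (0 + q + r = r)%N by lia.
    by rewrite (@chain_sum_strict _ _ 0%N) ?tail0 //; lia.
  have -> : (0 + q + r = q.-1.+1 + r)%N by lia.
  by rewrite (@chain_sum_weak _ _ 0%N) ?prednK.
rewrite !addSn chain_sumS [RHS]/= -(tail0 d) elem_chain; apply: eq_big => [z|z _].
  by rewrite cT.
rewrite elem0; apply: IH; first lia.
move=> z'; rewrite /mono_step (_ : (p <= i)%N = false) /=; last lia.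
by rewrite (_ : (p + q <= i)%N = false) //; lia.
Qed.

Lemma mixed_sum f :
  \sum_(tau : {ffun 'I_(p + q + r) -> 'S_d} | mixed_monotone tau) f (\prod_i tau i)%g
  = elems (nseq p 1%N) (hsum 0 q (elem setT r f)) 1%g.
Proof. by rewrite mixed_sum_chain chain_sum_free. Qed.

End MixedSum.

Lemma mixed_sum_elems p q r : exists L : seq (rat * seq nat),
  all (fun cw => (sumn cw.2 == p + q + r) && all (leq 1) cw.2) L /\
  forall d (f : 'S_d -> rat),
  (\sum_(tau : {ffun 'I_(p + q + r) -> 'S_d} | mixed_monotone tau) f (\prod_i tau i)%g
   = \sum_(cw <- L) cw.1 * elems cw.2 f 1%g)%R.
Proof.
have [L [Lq LE]] := hsum_elems q.
(* An index 0 would violate the positivity of the indices, so the strict block is left out when r =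
   0. *)
exists [seq (cw.1, nseq p 1 ++ cw.2 ++ nseq (r != 0) r) | cw <- L]; split.
  apply/allP => _ /mapP[cw /(allP Lq) /andP[/eqP sq aq] ->] /=.
  rewrite !sumn_cat sq !sumn_nseq mul1n !all_cat aq !all_nseq orbT /=.
  by case: r => [|r'] /=; rewrite ?muln0 ?muln1 ?orbT addnA eqxx.
move=> d f; rewrite mixed_sum (elems_ext _ _ (LE d _)) elems_sum big_map.
apply: eq_bigr => cw _; congr (_ * _)%R; rewrite /elems !foldr_cat.
have e w (h h' : 'S_d -> rat) g : h =1 h' -> elems w h g = elems w h' g := elems_ext w g.
apply: (e) => g'; apply: (e) => g''; case: r => [|r'] //=; exact: elem0.
Qed.

(** For a single transposition the three kinds of block agree. This serves the case of degree 0. *)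
Lemma mixed_sum_single p q r : p + q + r = 1 -> forall d (f : 'S_d -> rat),
  (\sum_(tau : {ffun 'I_(p + q + r) -> 'S_d} | mixed_monotone tau) f (\prod_i tau i)%g
   = elems [:: 1] f 1%g)%R.
Proof.
move=> e d f; rewrite mixed_sum.
have [[-> [-> ->]]|[[-> [-> ->]]|[-> [-> ->]]]] : (p = 1 /\ q = 0 /\ r = 0) \/
  (p = 0 /\ q = 1 /\ r = 0) \/ (p = 0 /\ q = 0 /\ r = 1) by lia.
- by apply: elem_ext => g; apply: elem0.
- rewrite /= -tail0 elem_chain; apply: eq_bigr => z _; by rewrite !elem0.
- by [].
Qed.

(** * Polynomial functions and summation along a line *)

Section Antidifference.
Local Open Scope ring_scope.

(** The rising factorial X (X + 1) ... (X + n - 1), adapted to backward differences. *)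
Definition rising (n : nat) : {poly rat} := \prod_(i <- iota 0 n) ('X - (- i%:R)%:P).

Lemma rising_diff n x :
  (rising n.+1).[x] - (rising n.+1).[x - 1] = n.+1%:R * (rising n).[x].
Proof.
have rS k y : (rising k.+1).[y] = (rising k).[y] * (y + k%:R).
  rewrite /rising -addn1 iotaD big_cat big_seq1 hornerM add0n; congr (_ * _).
  by rewrite !hornerE opprK.
elim: n => [|n IH]; first by rewrite !rS /rising big_nil !hornerE; ring.
rewrite !rS in IH *; move: IH; rewrite -[n.+1]addn1 !natrD.
move: (rising n).[x] (rising n).[x - 1] => u v IH.
have -> : u * (x + n%:R) * (x + (n%:R + 1%:R)) - v * (x - 1 + n%:R) * (x - 1 + (n%:R + 1%:R))
  = (u * (x + n%:R) - v * (x - 1 + n%:R)) * (x + n%:R) + u * (x + n%:R) by ring.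
by rewrite IH; ring.
Qed.

Lemma antidifference n (P : {poly rat}) : (size P <= n)%N ->
  exists S : {poly rat}, [/\ (size S <= n.+1)%N, S.[0] = 0
    & forall x, S.[x] - S.[x - 1] = P.[x]].
Proof.
have sz k : size (rising k) = k.+1.
  by rewrite /rising -(big_map (fun i => - i%:R) xpredT (fun c => 'X - c%:P))
             size_prod_XsubC size_map size_iota.
have lc k : (rising k)`_k = 1.
  have := monic_prod_XsubC (iota 0 k) xpredT (fun i => - i%:R : rat).
  by rewrite -/(rising k) => /monicP; rewrite lead_coefE sz.
elim: n P => [|n IH] P sP.
  exists 0; split; rewrite ?size_poly0 ?horner0 // => x.
  by move: sP; rewrite leqn0 size_poly_eq0 => /eqP ->; rewrite !horner0 subr0.
(* The top coefficient is cancelled by a multiple of [rising n], whose antidifference is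
   [rising n.+1] divided by n + 1. *)
have [S [sS S0 SE]] : exists S : {poly rat}, [/\ (size S <= n.+1)%N, S.[0] = 0
    & forall x, S.[x] - S.[x - 1] = (P - P`_n *: rising n).[x]].
  apply: IH; apply/leq_sizeP => j; rewrite leq_eqVlt => /orP[/eqP <-|nj].
    by rewrite coefB coefZ lc mulr1 subrr.
  rewrite coefB coefZ (nth_default _ (leq_trans sP nj)).
  by rewrite [(rising n)`_j]nth_default ?sz // mulr0 subrr.
exists (S + (P`_n / n.+1%:R) *: rising n.+1); split.
- apply: leq_trans (size_polyD _ _) _; rewrite geq_max (leq_trans sS) //=.
  by apply: leq_trans (size_scale_leq _ _) _; rewrite sz.
- rewrite hornerD hornerZ S0 add0r; apply/eqP; rewrite mulf_eq0; apply/orP; right.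
  by rewrite /rising /= big_cons hornerM hornerXsubC oppr0 subr0 mul0r.
- move=> x; have h := rising_diff n x; have {SE} := SE x.
  rewrite !hornerE => SE.
  have -> : P.[x] = S.[x] - S.[x - 1] + P`_n * (rising n).[x] by rewrite SE; ring.
  have -> : P`_n * (rising n).[x] = P`_n / n.+1%:R * ((rising n.+1).[x] - (rising n.+1).[x - 1]).
    by rewrite h mulrA divfK // pnatr_eq0.
  by ring.
Qed.

End Antidifference.

(** * Polynomial functions of integer vectors and their sums along a line *)

Section PolyFun.
Local Open Scope ring_scope.
Variable K : finType.
Implicit Types (b : K -> int) (f g : (K -> int) -> rat).

(** The index bounds the degree. Closure under pointwise equality takes the place of functional
    extensionality. *)
Inductive polyfun : nat -> ((K -> int) -> rat) -> Prop :=
| polyfun_cst D c : polyfun D (fun _ => c)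
| polyfun_var D k f : polyfun D f -> polyfun D.+1 (fun b => (b k)%:~R * f b)
| polyfun_add D f g : polyfun D f -> polyfun D g -> polyfun D (fun b => f b + g b)
| polyfun_ext D f g : f =1 g -> polyfun D f -> polyfun D g.

Lemma polyfun_weaken D D' f : (D <= D')%N -> polyfun D f -> polyfun D' f.
Proof.
move=> h pf; elim: pf D' h => [{}D c|{}D k {}f _ IH|{}D {}f g _ IH1 _ IH2|{}D {}f g fg _ IH] D' h.
- exact: polyfun_cst.
- by case: D' h => // D' h; apply: polyfun_var; apply: IH.
- by apply: polyfun_add; [apply: IH1|apply: IH2].
- by apply: polyfun_ext fg _; apply: IH.
Qed.

Lemma polyfun_scale D c f : polyfun D f -> polyfun D (fun b => c * f b).
Proof.
elim=> [{}D c'|{}D k {}f _ IH|{}D {}f g _ IH1 _ IH2|{}D {}f g fg _ IH].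
- exact: polyfun_cst.
- by apply: polyfun_ext (polyfun_var k IH) => b; ring.
- by apply: polyfun_ext (polyfun_add IH1 IH2) => b; ring.
- by apply: polyfun_ext IH => b; rewrite fg.
Qed.

Lemma polyfun_mul D E f g : polyfun D f -> polyfun E g ->
  polyfun (D + E) (fun b => f b * g b).
Proof.
move=> pf pg; elim: pf => [{}D c|{}D k {}f _ IH|{}D {}f f' _ IH1 _ IH2|{}D {}f f' ff _ IH].
- by apply: polyfun_weaken (leq_addl _ _) _; apply: polyfun_scale.
- by rewrite addSn; apply: polyfun_ext (polyfun_var k IH) => b; ring.
- by apply: polyfun_ext (polyfun_add IH1 IH2) => b; ring.
- by apply: polyfun_ext IH => b; rewrite ff.
Qed.

Lemma polyfun_sum (I : eqType) (w : seq I) D (h : I -> (K -> int) -> rat) :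
  (forall i, i \in w -> polyfun D (h i)) -> polyfun D (fun b => \sum_(i <- w) h i b).
Proof.
elim: w => [|i w IH] hw.
  by apply: polyfun_ext (polyfun_cst D 0) => b; rewrite big_nil.
have hi : polyfun D (h i) by apply: hw; rewrite mem_head.
have {}IH : polyfun D (fun b => \sum_(i <- w) h i b).
  by apply: IH => j jw; apply: hw; rewrite inE jw orbT.
by apply: polyfun_ext (polyfun_add hi IH) => b; rewrite big_cons.
Qed.

Lemma polyfun_horner D f (P : {poly rat}) : polyfun 1 f -> (size P <= D.+1)%N ->
  polyfun D (fun b => P.[f b]).
Proof.
move=> pf sP.
apply: (@polyfun_ext _ (fun b => \sum_(i <- iota 0 D.+1) P`_i * f b ^+ i)) => [b|].
  by rewrite (horner_coef_wide _ sP) -(big_mkord xpredT (fun i => P`_i * f b ^+ i)) /index_iota subn0.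
apply: polyfun_sum => i; rewrite mem_iota => /andP[_ iD]; apply: polyfun_scale.
apply: (@polyfun_weaken i); first by lia.
elim: i {iD} => [|i IH].
  by apply: polyfun_ext (polyfun_cst 0 1) => b; rewrite expr0.
by apply: polyfun_ext (polyfun_mul pf IH) => b; rewrite exprS.
Qed.

(** Taylor expansion along [a]: the coefficient of t^i loses i degrees, so substituting an affine
    function of b for t does not raise the degree. *)
Lemma polyfun_shift D f (a : K -> int) : polyfun D f ->
  exists g : nat -> (K -> int) -> rat,
    (forall i, (i <= D)%N -> polyfun (D - i) (g i)) /\
    forall b (t : int), f (fun x => b x - t * a x) = \sum_(i < D.+1) t%:~R ^+ i * g i b.
Proof.
elim=> [{}D c|{}D k {}f _ [g [pg IH]]|{}D {}f f' _ [g [pg IH]] _ [g' [pg' IH']]|{}D {}f f' ff _ [g [pg IH]]].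
- exists (fun i _ => if i is 0%N then c else 0); split=> [[|i] _|b t]; [exact: polyfun_cst..|].
  by rewrite big_ord_recl expr0 mul1r big1 ?addr0 // => i _; rewrite lift0 mulr0.
- exists (fun i b => (if (i <= D)%N then (b k)%:~R * g i b else 0) +
                 (- (a k)%:~R) * (if i is j.+1 then g j b else 0)); split=> [i iD|b t].
    apply: polyfun_add; last first.
      apply: polyfun_scale; case: i iD => [|j] iD; first exact: polyfun_cst.
      by rewrite subSS; apply: pg.
    case h: (i <= D)%N; last exact: polyfun_cst.
    by rewrite subSn //; apply: polyfun_var; apply: pg.
  rewrite IH rmorphB rmorphM /= mulrBl.
  under [RHS]eq_bigr => i _ do rewrite mulrDr.
  rewrite big_split /=; congr (_ + _).
    rewrite [RHS]big_ord_recr /= (_ : (D.+1 <= D)%N = false) ?ltnn // mulr0 addr0 mulr_sumr; apply: eq_bigr => i _.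
    by rewrite -ltnS ltn_ord; ring.
  rewrite [RHS]big_ord_recl /= !mulr0 add0r -mulNr mulr_sumr; apply: eq_bigr => i _.
  by rewrite /bump /= add1n exprS; ring.
- exists (fun i b => g i b + g' i b); split=> [i iD|b t].
    by apply: polyfun_add; [apply: pg|apply: pg'].
  by rewrite IH IH' -big_split; apply: eq_bigr => i _; rewrite mulrDr.
- by exists g; split=> // b t; rewrite -ff IH.
Qed.

(** [G b] is the antidifference in t of [f] along the line. Each t^i becomes a polynomial of degree
    i + 1 while its coefficient has degree at most D - i, so a sum up to an affine limit [U] costs
    one degree in all. *)
Lemma polyfun_line_sum D f (a : K -> int) : polyfun D f ->
  exists G : (K -> int) -> int -> rat,
  [/\ forall b, G b 0 = 0,
      forall b t, G b t - G b (t - 1) = f (fun x => b x - t * a x)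
    & forall (U : (K -> int) -> int), polyfun 1 (fun b => (U b)%:~R) ->
        polyfun D.+1 (fun b => G b (U b))].
Proof.
move=> /(polyfun_shift a)[g [pg gE]].
have [S hS] : exists S : nat -> {poly rat}, forall i, (i < D.+1)%N ->
   [/\ (size (S i) <= i.+2)%N, (S i).[0] = 0 & forall x, (S i).[x] - (S i).[x - 1] = x ^+ i].
  elim: D.+1 => [|n [S IH]]; first by exists (fun _ => 0).
  have [|Sn [h1 h2 h3]] := @antidifference n.+1 'X^n; first by rewrite size_polyXn.
  exists (fun i => if i == n then Sn else S i) => i.
  case: eqP => [-> _|ne h]; last by apply: IH; lia.
  by split=> // x; rewrite h3 hornerXn.
exists (fun b t => \sum_(i < D.+1) (S i).[t%:~R] * g i b); split.
- by move=> b; apply: big1 => i _; have [_ -> _] := hS i (ltn_ord i); rewrite mul0r.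
- move=> b t; rewrite gE -sumrB; apply: eq_bigr => i _.
  have [_ _ h] := hS i (ltn_ord i).
  by rewrite -mulrBl rmorphB h.
- move=> U pU; apply: (@polyfun_ext _ (fun b => \sum_(i <- iota 0 D.+1) (S i).[(U b)%:~R] * g i b)).
    by move=> b; rewrite -(big_mkord xpredT (fun i => (S i).[(U b)%:~R] * g i b)) /index_iota subn0.
  apply: polyfun_sum => i; rewrite mem_iota => /andP[_ iD].
  have [sS _ _] := hS i iD.
  apply: (@polyfun_weaken (i.+1 + (D - i))); first by lia.
  by apply: polyfun_mul; [apply: polyfun_horner|apply: pg; lia].
Qed.

End PolyFun.

(** * Lattice points of cones over chambers *)

Section IntervalSum.
Local Open Scope ring_scope.
Variables (F : finType) (l : F -> int) (e : F -> bool).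

(* Ties between equally tight constraints are broken in favour of the weak ones:
   the comparison of two constraints with thresholds in {0, 1} then again has a
   threshold in {0, 1}, so that it is decided by the side of a wall. *)
Definition pref (h f : F) : bool :=
  (e f && ~~ e h) || ((e f == e h) && (enum_rank f < enum_rank h)%N).

(** One integer for the lexicographic order on (l f - e f, e f, rank of f): [e f] is a bit and the
    rank is below #|F|. The constraint of smallest key on each side is the tight one. *)
Definition key (f : F) : int :=
  ((l f - (e f)%:Z) *+ 2 + (e f)%:Z) * (#|F|)%:Z + (enum_rank f : nat)%:Z.

Lemma key_pref h f : key h <= key f -> f != h -> (pref h f)%:Z <= l f - l h.
Proof.
rewrite /key /pref => k nfh.
have nr : (enum_rank f : nat) <> enum_rank h by move=> /val_inj /enum_rank_inj /eqP; apply/negP.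
have := ltn_ord (enum_rank f); have := ltn_ord (enum_rank h).
move: (enum_rank f : nat) (enum_rank h : nat) nr k => i j nr k; rewrite -[#|xpredT|]/(#|F|).
move: #|F| k => c k ci cj.
have ax x y : x * c%:Z + j%:Z <= y * c%:Z + i%:Z -> 0 <= y - x /\ (y = x -> (j <= i)%N).
  move=> xy; split=> [|yx]; last by move: xy; rewrite yx; lia.
  rewrite subr_ge0 leNgt; apply/negP => yx.
  have : 0 <= (x - y - 1) * c%:Z by apply: mulr_ge0; lia.
  rewrite !mulrBl; lia.
have [] := ax _ _ k; case: (e f) (e h) {k} => [] [] /=; case: (ltnP i j) => /=; lia.
Qed.

Lemma pref_uniq h h' : (pref h h')%:Z <= l h' - l h -> (pref h' h)%:Z <= l h - l h' -> h = h'.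
Proof.
move=> a b; apply/eqP; apply: contraT => nh.
have nr : (enum_rank h : nat) <> enum_rank h' by move=> /val_inj /enum_rank_inj /eqP; apply/negP.
move: a b; rewrite /pref; move: (enum_rank h : nat) (enum_rank h' : nat) nr => i j nr.
by case: (e h) (e h') => [] [] /=; case: (ltngtP i j) => /=; lia.
Qed.

Lemma pref_le h f : (pref h f)%:Z <= l f - l h -> l h - (e h)%:Z <= l f - (e f)%:Z.
Proof. rewrite /pref; case: (e f) (e h) => [] [] /=; lia. Qed.

Lemma exists_pref (P : pred F) f0 : P f0 ->
  exists2 h, P h & forall f, P f -> f != h -> (pref h f)%:Z <= l f - l h.
Proof.
move=> Pf0; case: (@Order.TotalTheory.arg_minP _ _ _ f0 P key Pf0) => h Ph hmin.
by exists h => // f Pf; apply: key_pref; apply: hmin.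
Qed.

Lemma telescope_interval (G : int -> rat) (A B : int) (M : nat) :
  (1 <= B -> A <= B -> B <= M%:Z) ->
  \sum_(1 <= t < M.+1) (if (A <= t%:Z) && (t%:Z <= B) then G t%:Z - G (t%:Z - 1) else 0)
  = if (1 <= B) && (A <= B) then G B - G (Num.max 1 A - 1) else 0.
Proof.
move=> hM; case: ifP => [/andP[B1 AB]|nB]; last first.
  rewrite big_nat big1 // => t /andP[t1 _]; case: ifP => // /andP[At tB].
  by move: nB => /negP; case; lia.
have {}hM := hM B1 AB.
have [a ea] : exists a : nat, Num.max 1 A = a%:Z by exists (absz (Num.max 1 A)); lia.
have [c ec] : exists c : nat, B = c%:Z by exists (absz B); lia.
have a1 : (1 <= a)%N by lia. have ac : (a <= c)%N by lia. have cM : (c <= M)%N by lia.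
rewrite (big_cat_nat _ (n := c.+1)) //= [X in _ + X]big_nat [X in _ + X]big1 ?addr0; last first.
  by move=> t /andP[ct _]; rewrite ifN //; lia.
rewrite (big_cat_nat _ (n := a)) //=; last by lia.
rewrite big_nat big1 ?add0r; last by move=> t /andP[t1 ta]; rewrite ifN //; lia.
rewrite (@eq_big_nat _ _ _ _ _ _ (fun t : nat => (fun s : nat => G (s%:Z - 1)) t.+1 - (fun s : nat => G (s%:Z - 1)) t)).
  rewrite telescope_sumr ?ec ?ea; last by lia.
  by congr (G _ - _); lia.
move=> t /andP[at_ tc] /=; rewrite ifT; last by lia.
by congr (G _ - _); lia.
Qed.

Variables (Up Lo : pred F).

(** Says that [h] is tight at the upper end B = l h - e h. The test against a lower constraint has
    threshold [e f || e h] instead of e f + e h. It can thus pass for an empty interval, but only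
    with lower end B + 1, where the two end terms cancel. Likewise 1 <= l h lets B = 0 pass, where
    [G] vanishes. *)
Definition win_up h :=
  (1 <= l h) && [forall f, (Up f && (f != h) ==> ((pref h f)%:Z <= l f - l h)) &&
                  (Lo f ==> ((e f || e h)%:Z <= l f + l h))].
(** The first condition says that the lower end e h - l h is at least 1; otherwise the sum starts at
    t = 1 and its lower term is G 0 = 0. *)
Definition win_lo h :=
  ((~~ e h)%:Z <= - l h) && [forall f, (Lo f && (f != h) ==> ((pref h f)%:Z <= l f - l h)) &&
                  (Up f ==> ((e f || e h)%:Z <= l f + l h))].
Definition feasible (t : int) :=
  [forall f, (Up f ==> ((e f)%:Z <= l f - t)) && (Lo f ==> ((e f)%:Z <= l f + t))].

(* The sum over a lattice interval, written as a signed sum over the constraints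
   that can be tight at its ends. *)
Lemma interval_sum (G : int -> rat) (M : nat) f0 : Up f0 -> G 0 = 0 ->
  (forall t, 1 <= t -> feasible t -> t <= M%:Z) ->
  \sum_(1 <= t < M.+1) (if feasible t%:Z then G t%:Z - G (t%:Z - 1) else 0) =
  \sum_(h | Up h) (if win_up h then G (l h - (e h)%:Z) else 0)
  - \sum_(h | Lo h) (if win_lo h then G ((e h)%:Z - l h - 1) else 0).
Proof.
move=> Uf0 G0 hM; have [hi Uhi hiP] := exists_pref Uf0.
have up_le f : Up f -> l hi - (e hi)%:Z <= l f - (e f)%:Z.
  by move=> Uf; case: (eqVneq f hi) => [->//|ne]; apply: pref_le; apply: hiP.
rewrite (bigD1 hi) //= [X in _ + X - _]big1 ?addr0; last first.
  move=> h /andP[Uh nh]; case: ifP => // /andP[_ /forallP/(_ hi)].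
  rewrite Uhi eq_sym nh /= => /andP[a _]; case/eqP: (nh).
  by apply: (pref_uniq a); apply: hiP.
case: (pickP Lo) => [g Lg|Lo0]; last first.
  rewrite [X in _ - X]big_pred0 // subr0.
  have -> : win_up hi = (1 <= l hi).
    apply/andP/idP => [[]//|h1]; split=> //; apply/forallP => f; rewrite Lo0 andbT.
    by apply/implyP => /andP[Uf nf]; apply: hiP.
  have fe t : feasible t = (t <= l hi - (e hi)%:Z).
    apply/forallP/idP => [/(_ hi)|h f]; first by rewrite Uhi => /andP[/= a _]; lia.
    by rewrite Lo0 andbT; apply/implyP => /up_le; lia.
  have := @telescope_interval G 0 (l hi - (e hi)%:Z) M.
  rewrite (eq_bigr (fun t : nat => if feasible t%:Z then G t%:Z - G (t%:Z - 1) else 0)); last first.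
    by move=> t _; rewrite fe.
  move=> ->; last by move=> h1 h2; apply: hM; rewrite ?fe.
  rewrite (_ : Num.max 1 0 - 1 = 0) // G0 subr0.
  case: (boolP (1 <= l hi)) => h1; last by rewrite ifN //; lia.
  case: ifP => // nh; rewrite (_ : l hi - (e hi)%:Z = 0) ?G0 //; lia.
have [lo Llo loP] := exists_pref Lg.
have lo_le f : Lo f -> l lo - (e lo)%:Z <= l f - (e f)%:Z.
  by move=> Lf; case: (eqVneq f lo) => [->//|ne]; apply: pref_le; apply: loP.
rewrite [X in _ - X](bigD1 lo) //= [X in _ - (_ + X)]big1 ?addr0; last first.
  move=> h /andP[Lh nh]; case: ifP => // /andP[_ /forallP/(_ lo)].
  rewrite Llo eq_sym nh /= => /andP[a _]; case/eqP: (nh).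
  by apply: (pref_uniq a); apply: loP.
have orP_up f : Up f -> (e lo || e hi)%:Z <= l lo + l hi -> (e f || e lo)%:Z <= l f + l lo.
  move=> Uf; case: (eqVneq f hi) => [->|ne]; first by rewrite orbC addrC.
  have := hiP f Uf ne; rewrite /pref; case: (e f) (e hi) (e lo) => [] [] [] /=; lia.
have orP_lo f : Lo f -> (e lo || e hi)%:Z <= l lo + l hi -> (e f || e hi)%:Z <= l f + l hi.
  move=> Lf; case: (eqVneq f lo) => [->//|ne].
  have := loP f Lf ne; rewrite /pref; case: (e f) (e hi) (e lo) => [] [] [] /=; lia.
have -> : win_up hi = (1 <= l hi) && ((e lo || e hi)%:Z <= l lo + l hi).
  rewrite /win_up; congr andb; apply/forallP/idP => [/(_ lo)|h f].
    by rewrite Llo => /andP[_].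
  apply/andP; split; apply/implyP; first by move=> /andP[Uf nf]; apply: hiP.
  by move=> Lf; apply: orP_lo.
have -> : win_lo lo = ((~~ e lo)%:Z <= - l lo) && ((e lo || e hi)%:Z <= l lo + l hi).
  rewrite /win_lo; congr andb; apply/forallP/idP => [/(_ hi)|h f].
    by rewrite Uhi => /andP[_] /=; rewrite orbC addrC.
  apply/andP; split; apply/implyP; first by move=> /andP[Uf nf]; apply: loP.
  by move=> Uf; apply: orP_up.
have fe t : feasible t = ((e lo)%:Z - l lo <= t) && (t <= l hi - (e hi)%:Z).
  apply/forallP/idP => [h|/andP[h1 h2] f].
    have /andP[_] := h lo; have /andP[+ _] := h hi; rewrite Llo Uhi /=; lia.
  by apply/andP; split; apply/implyP; [move/up_le|move/lo_le]; lia.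
have := @telescope_interval G ((e lo)%:Z - l lo) (l hi - (e hi)%:Z) M.
rewrite (eq_bigr (fun t : nat => if feasible t%:Z then G t%:Z - G (t%:Z - 1) else 0)); last first.
  by move=> t _; rewrite fe.
move=> ->; last by move=> h1 h2; apply: hM; rewrite ?fe ?h2 //=.
move: (l lo) (l hi) => x y; clear -G0.
set C := (_ || _)%:Z <= _; set C1 := 1 <= y; set C2 := (~~ _)%:Z <= _.
set A := (e lo)%:Z - x; set U := y - (e hi)%:Z.
(* If [C] holds and the interval is empty, then A = U + 1, and G U cancels G (A - 1). *)
have AU : C -> A <= U + 1 by rewrite /C /A /U; case: (e lo) (e hi) => [] [] /=; lia.
have nC : ~~ C -> (A <= U) = false by rewrite /C /A /U; case: (e lo) (e hi) => [] [] /=; lia.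
have C2E : C2 = (1 <= A) by rewrite /C2 /A; case: (e lo) => /=; lia.
have C1E : C -> C2 -> C1 by rewrite /C /C1 /C2; case: (e lo) (e hi) => [] [] /=; lia.
have CE : C1 -> ~~ C2 -> C by rewrite /C /C1 /C2; case: (e lo) (e hi) => [] [] /=; lia.
have U1 : 1 <= U -> C1 by rewrite /C1 /U; lia.
have C1U : C1 -> 0 <= U by rewrite /C1 /U; lia.
case: (boolP C) => hC; last by rewrite (nC hC) !andbF subr0.
rewrite !andbT; case: (boolP C2) => h2.
  rewrite C1E // (_ : Num.max 1 A = A); last by move: h2; rewrite C2E; lia.
  case: ifP => // h; rewrite (_ : U = A - 1) ?subrr //.
  by move: h h2 (AU hC); rewrite C2E; case: (leP 1 U) => /=; case: (leP A U) => /=; lia.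
rewrite (_ : Num.max 1 A - 1 = 0) ?G0 ?subr0; last by move: h2; rewrite C2E; lia.
case: (boolP C1) => h1.
  case: ifP => // h; rewrite (_ : U = 0) ?G0 //.
  by move: h h2 (C1U h1); rewrite C2E; lia.
by rewrite ifN //; apply: contra h1 => /andP[/U1].
Qed.

End IntervalSum.

(** * Cuts of a graph, uncrossing, and exchange of basis edges *)

Section Cuts.
Local Open Scope ring_scope.
Variable K : finType.
Implicit Types (b : K -> int) (S X Y : {set K}) (u w : K).

Definition edge u w : K -> int := fun x => (x == u)%:Z - (x == w)%:Z.
Definition cut S b : int := \sum_(x in S) b x.
Definition balanced b : Prop := \sum_x b x = 0.

Lemma cut_edge S u w : cut S (edge u w) = (u \in S)%:Z - (w \in S)%:Z.
Proof.
have h v : \sum_(x in S) (x == v)%:Z = (v \in S)%:Z.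
  case: (boolP (v \in S)) => vS; last first.
    by rewrite big1 // => x xS; case: eqP => // xv; rewrite -xv xS in vS.
  by rewrite (bigD1 v) //= eqxx big1 // => x /andP[_ /negbTE ->].
by rewrite /cut sumrB !h.
Qed.

Lemma balanced_edge u w : balanced (edge u w).
Proof.
have := cut_edge setT u w; rewrite !inE subrr /cut => h; rewrite /balanced -{}[RHS]h.
by apply: eq_bigl => x; rewrite inE.
Qed.

Lemma cut_line S b a t : cut S (fun x => b x - t * a x) = cut S b - t * cut S a.
Proof. by rewrite /cut sumrB mulr_sumr. Qed.

Lemma balanced_line b a t : balanced b -> balanced a -> balanced (fun x => b x - t * a x).
Proof. by rewrite /balanced sumrB -mulr_sumr => -> ->; rewrite mulr0 subr0. Qed.

Lemma cutC S b : balanced b -> cut (~: S) b = - cut S b.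
Proof.
rewrite /balanced (bigID (mem S)) /= => h; apply/eqP; rewrite -addr_eq0 addrC; apply/eqP; rewrite -{}[RHS]h.
by congr (_ + _); apply: eq_bigl => x; rewrite !inE.
Qed.

Lemma cutUI X Y b : cut (X :|: Y) b + cut (X :&: Y) b = cut X b + cut Y b.
Proof.
rewrite /cut !(big_mkcond (fun x => x \in _)) -!big_split; apply: eq_bigr => x _ /=.
by rewrite !inE; case: (x \in X); case: (x \in Y); rewrite ?addr0 ?add0r.
Qed.

Section Span.
Variables (F : finType) (u w : F -> K) (coef : F -> (K -> int) -> int).
Hypothesis span : forall b, balanced b -> forall x, b x = \sum_f coef f b * edge (u f) (w f) x.

Lemma cut_span S b : balanced b ->
  cut S b = \sum_f coef f b * cut S (edge (u f) (w f)).
Proof.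
move=> bb; rewrite /cut (eq_bigr _ (fun x _ => span bb x)) exchange_big /=.
by apply: eq_bigr => f _; rewrite mulr_sumr.
Qed.

(* Uncrossing: of the union and the intersection, one is trivial on the span. *)
Lemma uncross X Y f :
  (forall f', cut X (edge (u f') (w f')) + cut Y (edge (u f') (w f')) = (f == f')%:Z) ->
  exists Z : {set K}, forall b, balanced b -> cut Z b = cut X b + cut Y b.
Proof.
move=> h.
have dich f' : cut (X :|: Y) (edge (u f') (w f')) = 0 /\ cut (X :&: Y) (edge (u f') (w f')) = (f == f')%:Z
  \/ cut (X :|: Y) (edge (u f') (w f')) = (f == f')%:Z /\ cut (X :&: Y) (edge (u f') (w f')) = 0.
  move: (h f'); rewrite !cut_edge !inE.
  by case: (u f' \in X) (u f' \in Y) (w f' \in X) (w f' \in Y) (f == f') => [] [] [] [] [] //=; lia.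
have z S b : (forall f', cut S (edge (u f') (w f')) = 0) -> balanced b -> cut S b = 0.
  by move=> hS bb; rewrite (cut_span _ bb) big1 // => f' _; rewrite hS mulr0.
case: (dich f) => -[h1 h2]; [exists (X :&: Y)|exists (X :|: Y)] => b bb; rewrite -cutUI.
  rewrite (@z (X :|: Y)) ?add0r // => f'; case: (eqVneq f f') => [<- //|ne].
  by case: (dich f') => -[-> _] //; rewrite (negbTE ne).
rewrite (@z (X :&: Y)) ?addr0 // => f'; case: (eqVneq f f') => [<- //|ne].
by case: (dich f') => -[_ ->] //; rewrite (negbTE ne).
Qed.

End Span.
End Cuts.

Section DualBasis.
Local Open Scope ring_scope.
Variables (K F : finType).
Implicit Types (b : K -> int) (u w : F -> K) (S : F -> {set K}).

(** In graph terms the edges form a spanning tree, and [S f] is the fundamental cut of f, which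
    computes the coordinate along f. *)
Definition dual_basis u w S :=
  (forall b, balanced b -> forall x, b x = \sum_f cut (S f) b * edge (u f) (w f) x) /\
  (forall f f', cut (S f) (edge (u f') (w f')) = (f == f')%:Z).

Definition upd (T : Type) (h : F -> T) f0 v f := if f == f0 then v else h f.

(** The new edge replaces [f0] in the tree. Its coordinates are 0, 1 or -1, so each new coordinate
    form is a cut up to sign, or a sum or difference of two cuts, which uncrossing makes a single
    cut. Hence the facets of the cones remain cuts throughout the recursion. *)
Lemma exchange u w S (f0 : F) (u0 w0 : K) (sg := fun f => cut (S f) (edge u0 w0)) :
  dual_basis u w S -> sg f0 != 0 ->
  exists S', [/\ dual_basis (upd u f0 u0) (upd w f0 w0) S',
    forall b, balanced b -> cut (S' f0) b = sg f0 * cut (S f0) b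
  & forall b f, f != f0 -> balanced b ->
      cut (S' f) b = cut (S f) b - sg f * sg f0 * cut (S f0) b].
Proof.
move=> [sp du] s0.
have sgv f : sg f = 0 \/ sg f = 1 \/ sg f = -1.
  by rewrite /sg cut_edge; case: (u0 \in S f); case: (w0 \in S f); rewrite /=; lia.
have s2 : sg f0 * sg f0 = 1 by move: s0; case: (sgv f0) => [->//|[->|->]].
pose L f b := if f == f0 then sg f0 * cut (S f0) b
              else cut (S f) b - sg f * sg f0 * cut (S f0) b.
have Ls f : f != f0 -> forall b, L f b = cut (S f) b - sg f * sg f0 * cut (S f0) b.
  by move=> ne b; rewrite /L (negbTE ne).
have L0 b : L f0 b = sg f0 * cut (S f0) b by rewrite /L eqxx.
have sp' b : balanced b -> forall x,
    b x = \sum_f L f b * edge (upd u f0 u0 f) (upd w f0 w0 f) x.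
  move=> bb x; rewrite (bigD1 f0) //= L0 /upd eqxx.
  rewrite (eq_bigr (fun f => cut (S f) b * edge (u f) (w f) x
       - sg f0 * cut (S f0) b * (sg f * edge (u f) (w f) x))); last first.
    by move=> f ne; rewrite (Ls f ne) (negbTE ne); ring.
  rewrite sumrB -mulr_sumr {1}(sp _ bb x) (bigD1 f0) //=.
  rewrite [in RHS](sp _ (balanced_edge u0 w0) x) [in RHS](bigD1 f0) //= -/(sg f0).
  set A := \sum_(f | _) sg f * _; set B := \sum_(f | _) _.
  transitivity ((sg f0 * sg f0) * cut (S f0) b * edge (u f0) (w f0) x + B); last by ring.
  by rewrite s2 mul1r.
have du' f f' : L f (edge (upd u f0 u0 f') (upd w f0 w0 f')) = (f == f')%:Z.
  case: (eqVneq f' f0) => [->|nf']; rewrite /upd ?eqxx ?(negbTE nf').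
    case: (eqVneq f f0) => [->|nf]; first by rewrite L0 -/(sg f0) s2.
    by rewrite Ls // -/(sg f0) -/(sg f) -mulrA s2 mulr1 subrr.
  case: (eqVneq f f0) => [->|nf]; first by rewrite L0 du eq_sym (negbTE nf') mulr0.
  by rewrite Ls // !du (eq_sym f0) (negbTE nf') mulr0 subr0.
have [S' hS'] : exists S' : F -> {set K}, forall f b, balanced b -> cut (S' f) b = L f b.
  apply: (@fin_all_exists F (fun _ => {set K}) (fun f Z => forall b, balanced b -> cut Z b = L f b)) => f.
  (* Signs are absorbed by complements: on balanced vectors the complement has the opposite cut
     value. *)
  case: (eqVneq f f0) => [->|nf].
    case: (sgv f0) s0 => [->//|[e|e] _]; [exists (S f0)|exists (~: S f0)] => b bb; rewrite L0 e.
      by rewrite mul1r.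
    by rewrite mulN1r cutC.
  have [e|[e|e]] : sg f * sg f0 = 0 \/ sg f * sg f0 = 1 \/ sg f * sg f0 = -1.
  - by case: (sgv f) (sgv f0) => [->|[->|->]] [->|[->|->]]; rewrite ?mul0r ?mulr0; lia.
  - by exists (S f) => b bb; rewrite Ls // e mul0r subr0.
  - have [|Z hZ] := @uncross _ _ _ _ _ sp' (S f) (~: S f0) f.
      by move=> f'; rewrite (cutC _ (balanced_edge _ _)) -du' Ls // e mul1r.
    by exists Z => b bb; rewrite hZ // cutC // Ls // e mul1r.
  - have [|Z hZ] := @uncross _ _ _ _ _ sp' (S f) (S f0) f.
      by move=> f'; rewrite -du' Ls // e mulN1r opprK.
    by exists Z => b bb; rewrite hZ // Ls // e mulN1r opprK.
exists S'; split.
- split=> [b bb x|f f'].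
    by rewrite (sp' b bb); apply: eq_bigr => f _; rewrite hS'.
  by rewrite hS' ?du' //; apply: balanced_edge.
- by move=> b bb; rewrite hS' // L0.
- by move=> b f ne bb; rewrite hS' // Ls.
Qed.

End DualBasis.

(** * Summation of cone functions along an edge *)

Section Cones.
Local Open Scope ring_scope.
Variables (K F : finType) (src : {set K}).
Implicit Types (b : K -> int).

(* A polynomial function restricted to the cone of those b whose coordinates in
   a basis of edge vectors are nonnegative (strictly so if [ceps] holds) on the
   active basis edges and vanish on the others. *)
Record cone := Cone {
  cu : F -> K; cw : F -> K; cS : F -> {set K};
  cact : {set F}; ceps : F -> bool; cQ : (K -> int) -> rat }.

Definition cond c b f : bool :=
  if f \in cact c then (ceps c f)%:Z <= cut (cS c f) b else cut (cS c f) b == 0.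

Definition cterm c b : rat := if [forall f, cond c b f] then cQ c b else 0.

(** [N] counts the edges summed over so far: each summation raises either the degree or the number
    of active edges by one. *)
Definition wf (N : nat) c : Prop :=
  [/\ dual_basis (cu c) (cw c) (cS c),
      forall f, f \in cact c -> (cu c f \in src) && (cw c f \notin src)
    & exists2 D, polyfun D (cQ c) & (D + #|cact c| <= N)%N].

(** Every active edge leaves [src], so the cut at [src] is the sum of the active coordinates. Hence
    a line going backwards along a new edge out of [src] leaves the cone, and the sums over t are
    finite. *)
Lemma cone_src_ge0 N c b : wf N c -> balanced b -> [forall f, cond c b f] -> 0 <= cut src b.
Proof.
case=> [[sp _] hact _] bb /forallP h; rewrite (cut_span sp _ bb).
apply: sumr_ge0 => f _; have := h f; rewrite /cond; case: ifP => fa; last by move/eqP->; rewrite mul0r.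
have /andP[uf wf] := hact f fa; rewrite cut_edge uf (negbTE wf) subr0 mulr1.
by apply: le_trans.
Qed.

Lemma wf_zero N c : wf N c -> wf N (Cone (cu c) (cw c) (cS c) (cact c) (ceps c) (fun _ => 0)).
Proof.
case=> h1 h2 [D _ h3]; split=> //; exists 0%N; first exact: polyfun_cst.
by apply: leq_trans h3 => /=; rewrite leq_add2r.
Qed.

Lemma cterm_zero u w S A e b : cterm (Cone u w S A e (fun _ => 0)) b = 0.
Proof. by rewrite /cterm; case: ifP. Qed.

Lemma polyfun_cut S : polyfun 1 (fun b => (cut S b)%:~R).
Proof.
apply: (@polyfun_ext _ _ (fun b => \sum_(x <- enum S) (b x)%:~R * 1)).
  move=> b; rewrite /cut -big_enum rmorph_sum; apply: eq_bigr => x _; exact: mulr1.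
by apply: polyfun_sum => x _; apply: polyfun_var; apply: polyfun_cst.
Qed.

Lemma polyfun_affine S (c1 c2 : int) : polyfun 1 (fun b => (c1 * cut S b + c2)%:~R).
Proof.
apply: (@polyfun_ext _ _ (fun b => c1%:~R * (cut S b)%:~R + c2%:~R)).
  by move=> b; rewrite rmorphD rmorphM.
by apply: polyfun_add; [apply/polyfun_scale/polyfun_cut|apply: polyfun_cst].
Qed.

Section Step.
Variables (N : nat) (c : cone) (u0 w0 : K).
Hypotheses (wfc : wf N c) (u0s : u0 \in src) (w0s : w0 \notin src).
Let sg f := cut (cS c f) (edge u0 w0).
Let line b (t : int) : K -> int := fun x => b x - t * edge u0 w0 x.

Let sgv f : sg f = 0 \/ sg f = 1 \/ sg f = -1.
Proof. by rewrite /sg cut_edge; case: (u0 \in _); case: (w0 \in _); rewrite /=; lia. Qed.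

Let balanced_edge_line b t : balanced b -> balanced (line b t).
Proof. by move=> bb; apply: balanced_line => //; apply: balanced_edge. Qed.

Let line_le b t : balanced b -> [forall f, cond c (line b t) f] -> t <= cut src b.
Proof.
move=> bb /(cone_src_ge0 wfc (balanced_edge_line t bb)).
by rewrite cut_line cut_edge u0s (negbTE w0s) subr0 mulr1 subr_ge0.
Qed.

(** By [line_le] the terms with t > [M] vanish, so the left side is the sum over all t >= 1. *)
Definition decomposed : Prop := exists cs : F -> cone,
  (forall f, wf N.+1 (cs f)) /\
  forall b, balanced b -> forall M : nat, cut src b <= M%:Z ->
    \sum_(1 <= t < M.+1) cterm c (line b t%:Z) = \sum_f cterm (cs f) b.

(** The coordinate along [f0] must vanish, which determines t as an affine function of b. The new
    edge takes the place of [f0] and becomes active, strictly so because t >= 1; the degree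
    stays. *)
Lemma step_inactive f0 : f0 \notin cact c -> sg f0 != 0 -> decomposed.
Proof.
move=> f0a s0; have [db ha [D pf hD]] := wfc.
have [S' [db' S0 S1]] := exchange db s0.
have s2 : sg f0 * sg f0 = 1 by move: s0; case: (sgv f0) => [->//|[->|->]].
have [g [pg gE]] := polyfun_shift (edge u0 w0) pf.
pose t0 b := sg f0 * cut (cS c f0) b.
pose Q' b := \sum_(i <- iota 0 D.+1) ('X^i).[(sg f0 * cut (cS c f0) b + 0)%:~R] * g i b.
have Q'E b : Q' b = cQ c (line b (t0 b)).
  rewrite gE -(big_mkord xpredT (fun i => (t0 b)%:~R ^+ i * g i b)) /index_iota subn0.
  by apply: eq_bigr => i _; rewrite hornerXn addr0.
pose c' := Cone (upd (cu c) f0 u0) (upd (cw c) f0 w0) S' (f0 |: cact c)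
             (fun f => if f == f0 then true else ceps c f) Q'.
have wfc' : wf N.+1 c'.
  split=> //= [f|].
    rewrite !inE /upd; case: eqP => [_ _|_ /= fa]; first by rewrite u0s.
    exact: ha.
  exists D; last by rewrite cardsU1 f0a; lia.
  apply: polyfun_sum => i; rewrite mem_iota => /andP[_ iD].
  apply: (@polyfun_weaken _ (i + (D - i))); first by lia.
  apply: polyfun_mul; last by apply: pg; lia.
  by apply: polyfun_horner; [apply: polyfun_affine|rewrite size_polyXn].
exists (fun f => if f == f0 then c' else Cone (cu c) (cw c) (cS c) (cact c) (ceps c) (fun _ => 0)).
split=> [f|b bb M hM].
  case: ifP => // _; apply: wf_zero; case: wfc => h1 h2 [D' h3 h4]; split=> //.
  by exists D' => //; apply: ltnW.
rewrite (bigD1 f0) //= eqxx [X in _ = _ + X]big1 ?addr0; last first.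
  by move=> f /negbTE ->; rewrite cterm_zero.
have ct : cterm c' b = if (1 <= t0 b) then cterm c (line b (t0 b)) else 0.
  rewrite /cterm -Q'E.
  have -> : [forall f, cond c' b f] = (1 <= t0 b) && [forall f, cond c (line b (t0 b)) f].
    have c0 : cond c' b f0 = (1 <= t0 b) by rewrite /cond /= !inE eqxx /= S0.
    have c1 f : f != f0 -> cond c' b f = cond c (line b (t0 b)) f.
      move=> ne; rewrite /cond /= !inE (negbTE ne) /= S1 // cut_line -/(sg f) /t0.
      by rewrite (_ : sg f * sg f0 * cut (cS c f0) b = sg f0 * cut (cS c f0) b * sg f) //; ring.
    apply/forallP/andP => [h|[h1 /forallP h2] f].
      split; first by rewrite -c0.
      apply/forallP => f; case: (eqVneq f f0) => [->|ne]; last by rewrite -c1.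
      rewrite /cond (negbTE f0a) cut_line -/(sg f0) /t0 mulrAC s2 mul1r subrr //.
    by case: (eqVneq f f0) => [->|ne]; [rewrite c0|rewrite c1].
  by case: (1 <= t0 b).
rewrite ct; have z (t : int) : t != t0 b -> cterm c (line b t) = 0.
  move=> ne; rewrite /cterm ifN //; apply/negP => /forallP/(_ f0).
  rewrite /cond (negbTE f0a) cut_line -/(sg f0) subr_eq0 => /eqP e.
  by case/eqP: ne; rewrite /t0 e mulrCA s2 mulr1.
case: ifP => h1; last first.
  rewrite big_nat big1 // => t /andP[t1 _]; apply: z; apply: contraFneq h1 => <-; lia.
have [n en] : exists n : nat, t0 b = n%:Z by exists (absz (t0 b)); lia.
case: (leqP n M) => nM; last first.
  rewrite big_nat big1; last by move=> t /andP[_ tM]; apply: z; rewrite en; lia.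
  by rewrite /cterm; case: ifP => // /(line_le bb); rewrite en; lia.
have -> : index_iota 1 M.+1 = index_iota 1 n ++ n :: index_iota n.+1 M.+1.
  rewrite /index_iota (_ : (M.+1 - 1)%N = ((n - 1) + (M - n).+1)%N); last by lia.
  have n1 : (1 + (n - 1))%N = n by lia.
  by rewrite iotaD /= n1 subSS.
rewrite big_cat big_cons /= -en big_nat big1 ?add0r; last first.
  by move=> t /andP[_ tn]; apply: z; rewrite en; lia.
by rewrite big_nat big1 ?addr0 // => t /andP[tn _]; apply: z; rewrite en; lia.
Qed.

(** Here the new edge is a combination of active edges, so t runs over an interval and the sum is an
    antidifference at its ends. If [f0] is tight at an end, that end is affine in b, and the
    inequalities expressing tightness are those of the cone in which the new edge replaces [f0]. *)
Lemma step_active : (forall f, f \notin cact c -> sg f = 0) -> decomposed.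
Proof.
move=> inact; have [db ha [D pf hD]] := wfc.
have [G [G0 GS pG]] := polyfun_line_sum (edge u0 w0) pf.
pose l b f := cut (cS c f) b.
pose Up := [pred f | (f \in cact c) && (sg f == 1)].
pose Lo := [pred f | (f \in cact c) && (sg f == -1)].
pose rest b := [forall f, (sg f == 0) ==> cond c b f].
pose e := ceps c.
pose val b f0 := if ~~ rest b then 0 else
  if Up f0 then (if win_up (l b) e Up Lo f0 then G b (l b f0 - (e f0)%:Z) else 0)
  else if Lo f0 then - (if win_lo (l b) e Up Lo f0 then G b ((e f0)%:Z - l b f0 - 1) else 0)
  else 0.
(* The new edge and all active edges leave [src]; comparing cuts at [src], the coefficients of the
   new edge sum to 1, so one of them is positive and bounds t from above. *)
have [fu Ufu] : exists f, Up f.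
  apply/existsP; apply: contraT; rewrite negb_exists => /forallP nU.
  have := cut_edge src u0 w0; rewrite u0s (negbTE w0s) subr0.
  have [sp _] := db; rewrite (cut_span sp _ (balanced_edge u0 w0)) => h.
  suff : \sum_f sg f * cut src (edge (cu c f) (cw c f)) <= 0 by rewrite h.
  apply: sumr_le0 => f _; case: (boolP (f \in cact c)) => fa; last by rewrite inact // mul0r.
  have /andP[uf wf] := ha f fa; rewrite cut_edge uf (negbTE wf) subr0 mulr1.
  by have := nU f; rewrite /= fa /=; case: (sgv f) => [->|[->|->]].
have restE b t : [forall f, cond c (line b t) f] = rest b && feasible (l b) e Up Lo t.
  have cl f : cond c (line b t) f = if f \in cact c then (e f)%:Z <= l b f - t * sg f else l b f - t * sg f == 0.
    by rewrite /cond !cut_line.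
  apply/forallP/andP => [h|[/forallP h1 /forallP h2] f].
    split; apply/forallP => f; have := h f; rewrite cl.
      move=> hf; apply/implyP => /eqP s0; move: hf; rewrite s0 mulr0 subr0 /cond; by case: ifP.
    rewrite /Up /Lo /=; case: ifP => //= fa hf.
    by case: (sgv f) hf => [->|[->|->]]; rewrite ?mulr0 ?subr0 ?mulr1 ?mulrN1 ?opprK //= ?andbT.
  rewrite cl; have := h1 f; have := h2 f; rewrite /Up /Lo /cond /=.
  case: ifP => [fa|fa]; last by rewrite inact ?fa //= mulr0 subr0.
  case: (sgv f) => [->|[->|->]]; rewrite ?eqxx /= ?mulr0 ?subr0 ?mulr1 ?mulrN1 ?opprK //.
    by move=> /andP[].
have new f0 : exists c', wf N.+1 c' /\ forall b, balanced b -> cterm c' b = val b f0.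
  case: (boolP (Up f0 || Lo f0)) => hf0; last first.
    exists (Cone (cu c) (cw c) (cS c) (cact c) (ceps c) (fun _ => 0)); split.
      by apply: wf_zero; split=> //; exists D => //; apply: ltnW.
    by move=> b _; rewrite cterm_zero /val; move: hf0; rewrite negb_or; case: ifP => // _ /andP[/negbTE -> /negbTE ->].
  have fa0 : f0 \in cact c by case/orP: hf0 => /andP[].
  have sf0 : sg f0 = 1 \/ sg f0 = -1 by case/orP: hf0 => /andP[_ /eqP]; auto.
  have s0 : sg f0 != 0 by case: sf0 => ->.
  have [S' [db' S0 S1]] := exchange db s0.
  (* Thresholds of the new cone: constraints free of t keep theirs, those on the side of [f0] are
     compared by [pref], those on the other side get the disjunction from [win_up] and [win_lo]. *)
  pose e' f := if f == f0 then (if sg f0 == 1 then true else ~~ e f0)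
               else if sg f == 0 then e f else if sg f == sg f0 then pref e f0 f else e f || e f0.
  pose Q' b := if sg f0 == 1 then G b (l b f0 - (e f0)%:Z) else (-1) * G b ((e f0)%:Z - l b f0 - 1).
  exists (Cone (upd (cu c) f0 u0) (upd (cw c) f0 w0) S' (cact c) e' Q'); split.
    split=> //= [f fa|].
      by rewrite /upd; case: eqP => [_|_]; [rewrite u0s|apply: ha].
    exists D.+1; last by rewrite addSn.
    rewrite /Q'; case: (sg f0 == 1).
      apply: (pG (fun b => l b f0 - (e f0)%:Z)).
      by apply: polyfun_ext (polyfun_affine (cS c f0) 1 (- (e f0)%:Z)) => b; rewrite mul1r.
    apply: polyfun_scale; apply: (pG (fun b => (e f0)%:Z - l b f0 - 1)).
    apply: polyfun_ext (polyfun_affine (cS c f0) (-1) ((e f0)%:Z - 1)) => b.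
    by rewrite mulN1r addrCA addrA.
  move=> b bb; rewrite /cterm /=.
  set c' := Cone _ _ _ _ _ _.
  have C0 : cond c' b f0 = ((e' f0)%:Z <= sg f0 * l b f0) by rewrite /cond /= fa0 S0.
  have C1 f : f != f0 -> f \in cact c -> cond c' b f = ((e' f)%:Z <= l b f - sg f * sg f0 * l b f0).
    by move=> ne fa; rewrite /cond /= fa S1.
  have C2 f : f != f0 -> sg f = 0 -> cond c' b f = cond c b f.
    by move=> ne sf; rewrite /cond /= S1 // -/(sg f) sf !mul0r subr0 /e' (negbTE ne) sf eqxx.
  case/orP: hf0 => hf0.
    have s1 : sg f0 = 1 by case/andP: hf0 => _ /eqP.
    have -> : [forall f, cond c' b f] = rest b && win_up (l b) e Up Lo f0.
      rewrite s1 mul1r /e' eqxx s1 eqxx /= in C0.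
      apply/forallP/and3P => [h|[/forallP h1 h2 /forallP h3] f].
        split; last 1 first.
        - apply/forallP => f; apply/andP; split; apply/implyP => /=.
            move=> /andP[/andP[fa /eqP sf] ne]; have := h f.
            by rewrite C1 // /e' (negbTE ne) sf s1 /= !mul1r.
          move=> /andP[fa /eqP sf]; have ne : f != f0 by apply/eqP => ff; move: sf; rewrite ff s1.
          by have := h f; rewrite C1 // /e' (negbTE ne) sf s1 /= mulr1 mulN1r opprK.
        - apply/forallP => f; apply/implyP => /eqP sf; rewrite -C2 //.
          by apply/eqP => ff; move: sf; rewrite ff s1.
        - by rewrite -C0.
      case: (eqVneq f f0) => [->|ne]; first by rewrite C0.
      have := h1 f; have := h3 f; rewrite /= ne /=.
      case: (boolP (f \in cact c)) => fa; last by rewrite C2 // ?inact // eqxx /= => _.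
      case: (sgv f) => [sf|[sf|sf]]; first by rewrite C2 // sf eqxx.
        by rewrite C1 // /e' (negbTE ne) sf s1 /= !mul1r andbT.
      by rewrite C1 // /e' (negbTE ne) sf s1 /= mulr1 mulN1r opprK.
    rewrite /val hf0 /Q' s1 eqxx; by case: (rest b).
  have s1 : sg f0 = -1 by case/andP: hf0 => _ /eqP.
  have nUp : Up f0 = false by rewrite /= s1 andbF.
  have -> : [forall f, cond c' b f] = rest b && win_lo (l b) e Up Lo f0.
    rewrite s1 mulN1r /e' eqxx s1 /= in C0.
    apply/forallP/and3P => [h|[/forallP h1 h2 /forallP h3] f].
      split; last 1 first.
      - apply/forallP => f; apply/andP; split; apply/implyP => /=.
          move=> /andP[/andP[fa /eqP sf] ne]; have := h f.
          by rewrite C1 // /e' (negbTE ne) sf s1 /= mulN1r opprK mul1r.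
        move=> /andP[fa /eqP sf]; have ne : f != f0 by apply/eqP => ff; move: sf; rewrite ff s1.
        by have := h f; rewrite C1 // /e' (negbTE ne) sf s1 /= mul1r mulN1r opprK.
      - apply/forallP => f; apply/implyP => /eqP sf; rewrite -C2 //.
        by apply/eqP => ff; move: sf; rewrite ff s1.
      - by rewrite -C0.
    case: (eqVneq f f0) => [->|ne]; first by rewrite C0.
    have := h1 f; have := h3 f; rewrite /= ne /=.
    case: (boolP (f \in cact c)) => fa; last by rewrite C2 // ?inact // eqxx /= => _.
    case: (sgv f) => [sf|[sf|sf]]; first by rewrite C2 // sf eqxx.
      by rewrite C1 // /e' (negbTE ne) sf s1 /= mul1r mulN1r opprK.
    by rewrite C1 // /e' (negbTE ne) sf s1 /= mulN1r opprK mul1r andbT.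
  by rewrite /val nUp hf0 /Q' s1 /=; case: (rest b) => //=; case: ifP => //; rewrite ?mulN1r ?oppr0.
have [cs hcs] := @fin_all_exists F (fun _ => cone) (fun f0 c' => wf N.+1 c' /\
  forall b, balanced b -> cterm c' b = val b f0) new.
exists cs; split=> [f|b bb M hM]; first by case: (hcs f).
rewrite [RHS](eq_bigr _ (fun f _ => (hcs f).2 b bb)).
case: (boolP (rest b)) => hr; last first.
  rewrite !big1 // => [f _|t _]; first by rewrite /val hr.
  by rewrite /cterm restE (negbTE hr).
transitivity (\sum_(1 <= t < M.+1) (if feasible (l b) e Up Lo t%:Z then G b t%:Z - G b (t%:Z - 1) else 0)).
  by apply: eq_bigr => t _; rewrite /cterm restE hr GS.
rewrite (@interval_sum _ _ _ _ _ _ _ fu) //; last first.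
  by move=> t _ ft; apply: le_trans hM; apply: line_le => //; rewrite restE hr.
rewrite [RHS](bigID Up) /= /val hr /=; congr (_ + _).
  by apply: eq_bigr => f ->.
rewrite -sumrN [RHS]big_mkcond [LHS]big_mkcond /=; apply: eq_bigr => f _.
case: (boolP (f \in cact c)) => //= fa.
by case: (sgv f) => [->|[->|->]] //=; rewrite ?oppr0.
Qed.

Lemma step : decomposed.
Proof.
case: (boolP [exists f, (f \notin cact c) && (sg f != 0)]).
  by case/existsP => f /andP[]; apply: step_inactive.
rewrite negb_exists => /forallP h; apply: step_active => f fa.
by have := h f; rewrite fa /= negbK => /eqP.
Qed.

End Step.
End Cones.

(** * Counting positive integral flows *)

Section FlowCount.
Local Open Scope ring_scope.
Variables (K F : finType) (src : {set K}).
Variables (u : F -> K) (w : F -> K) (S : F -> {set K}).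
Hypothesis db : dual_basis u w S.
Implicit Types (b : K -> int).

Definition is_flow N (eu ew : 'I_N -> K) b D (x : {ffun 'I_N -> 'I_D.+1}) : bool :=
  [forall i, 0 < x i]%N &&
  [forall k, b k == \sum_i (x i : nat)%:Z * edge (eu i) (ew i) k].

Lemma is_flow_fcons N (eu ew : 'I_N.+1 -> K) b D t (x : {ffun 'I_N -> 'I_D.+1}) :
  is_flow eu ew b (fcons t x) = (0 < t)%N &&
    is_flow (fun i => eu (lift ord0 i)) (fun i => ew (lift ord0 i))
      (fun k => b k - (t : nat)%:Z * edge (eu ord0) (ew ord0) k) x.
Proof.
rewrite /is_flow forall_ordS fcons0 -andbA; congr (_ && (_ && _)).
  by apply: eq_forallb => i; rewrite fconsS.
apply: eq_forallb => k; rewrite big_ord_recl fcons0 subr_eq addrC.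
by congr (_ == _ + _); apply: eq_bigr => i _; rewrite fconsS.
Qed.

(** Fixing the flow on the first edge moves b along a line, to which [step] applies. Without edges
    only b = 0 has a flow: this is the cone with no active edge. *)
Lemma flow_count_cones N (eu ew : 'I_N -> K) :
  (forall i, (eu i \in src) && (ew i \notin src)) ->
  exists (I : finType) (cs : I -> cone K F), (forall i, wf src N (cs i)) /\
  forall b, balanced b -> forall D : nat, cut src b <= D%:Z ->
    \sum_(x : {ffun 'I_N -> 'I_D.+1} | is_flow eu ew b x) 1 = \sum_i cterm (cs i) b.
Proof.
elim: N eu ew => [|N IH] eu ew he.
  exists unit, (fun _ => Cone u w S set0 (fun _ => false) (fun _ => 1)); split.
    by move=> _; split=> //= [f|]; [rewrite inE|exists 0%N; [exact: polyfun_cst|rewrite cards0]].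
  move=> b bb D _; rewrite (big_pred1 tt); last by case.
  rewrite /cterm.
  have -> : [forall f, cond (Cone u w S set0 (fun _ => false) (fun _ => 1)) b f]
     = [forall k, b k == 0].
    apply/forallP/forallP => h k; last first.
      by rewrite /cond inE /= /cut big1 // => x _; apply/eqP.
    have [sp _] := db; rewrite (sp b bb) big1 // => f _.
    by have := h f; rewrite /cond inE /= => /eqP ->; rewrite mul0r.
  case: ifP => h.
    rewrite (big_pred1 [ffun i : 'I_0 => ord0]) // => x; rewrite /is_flow.
    have -> : x = [ffun i : 'I_0 => ord0] by apply/ffunP => -[].
    rewrite /= eqxx; apply/andP; split; apply/forallP; first by case.
    move=> k; by rewrite big_ord0; apply: (forallP h).
  rewrite big_pred0 // => x; apply: contraFF h => /andP[_ /forallP h].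
  by apply/forallP => k; have := h k; rewrite big_ord0.
have [|I [cs [hcs hE]]] := IH (fun i => eu (lift ord0 i)) (fun i => ew (lift ord0 i)); first by [].
have /andP[e0 w0] := he ord0.
have [cs' hcs'] := @fin_all_exists I (fun _ => F -> cone K F) _ (fun i => step (hcs i) e0 w0).
exists (I * F)%type, (fun q => cs' q.1 q.2); split=> [[i f]|b bb D bD].
  by case: (hcs' i).
rewrite -(pair_bigA _ (fun i f => cterm (cs' i f) b)) /= big_fcons /=.
under [RHS]eq_bigr => i _ do rewrite -((hcs' i).2 b bb D bD).
rewrite exchange_big /= big_add1 /= big_mkord big_ord_recl /=.
rewrite big_pred0 ?add0r => [|x]; last by rewrite is_flow_fcons.
apply: eq_bigr => t _.
have bt := balanced_line (lift ord0 t : nat)%:Z bb (balanced_edge (eu ord0) (ew ord0)).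
rewrite -(hE _ bt D); last first.
  rewrite cut_line cut_edge e0 (negbTE w0) subr0 mulr1; apply: le_trans bD.
  by rewrite lerBlDr lerDl.
by apply: eq_bigl => x; rewrite is_flow_fcons.
Qed.

(** Off the walls a cone with an inactive edge contributes nothing, since one of its cuts would
    vanish; any other contributes on the whole chamber or nowhere. With all #|F| basis edges active,
    at most N - #|F| remains for the degree. *)
Lemma flow_count_chamber N (eu ew : 'I_N -> K) (side : {set K} -> bool) :
  (forall i, (eu i \in src) && (ew i \notin src)) ->
  exists2 f, polyfun (N - #|F|) f &
  forall b, balanced b ->
    (forall X, X != set0 -> X != setT -> if side X then 0 < cut X b else cut X b < 0) ->
    forall D : nat, cut src b <= D%:Z ->
    \sum_(x : {ffun 'I_N -> 'I_D.+1} | is_flow eu ew b x) 1 = f b.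
Proof.
move=> he; have [I [cs [hcs hE]]] := flow_count_cones he.
pose ok i := (cact (cs i) == setT) && [forall f, side (cS (cs i) f)].
exists (fun b => \sum_(i <- enum I) (if ok i then cQ (cs i) b else 0)).
  apply: polyfun_sum => i _; case hi: (ok i); last exact: polyfun_cst.
  have [_ _ [D pf h]] := hcs i; case/andP: hi h => /eqP -> _; rewrite cardsT => h.
  by apply: polyfun_weaken pf; lia.
move=> b bb hs D bD; rewrite (hE b bb D bD) big_enum; apply: eq_bigr => i _.
have [[_ du] _ _] := hcs i.
have nt f : cS (cs i) f != set0 /\ cS (cs i) f != setT.
  by split; apply/eqP => h; have := du f f; rewrite eqxx cut_edge h !inE.
rewrite /cterm; congr (if _ then _ else _).
apply/forallP/andP => [h|[/eqP hA /forallP hB] f]; last first.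
  have [n0 nT] := nt f; have := hs _ n0 nT; rewrite hB /cond hA inE.
  by case: (ceps _ _) => /=; lia.
have ha f : f \in cact (cs i).
  have [n0 nT] := nt f; have := hs _ n0 nT; have := h f; rewrite /cond.
  by case: ifP => // _ /eqP ->; case: ifP; rewrite ltxx.
split; first by apply/eqP/setP => f; rewrite ha inE.
apply/forallP => f; have [n0 nT] := nt f; have := hs _ n0 nT; have := h f; rewrite /cond ha.
case: (side _) => //; case: (ceps _ _) => /=; lia.
Qed.

End FlowCount.

Section StarBasis.
Local Open Scope ring_scope.

(* The coordinates b_k, k != k0, are cuts dual to the star of edges from k to k0. *)
Lemma star_basis (K : finType) (k0 : K) :
  dual_basis (fun f : {k : K | k != k0} => val f) (fun _ => k0) (fun f => [set val f]).
Proof.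
split=> [b bb x|f f']; last first.
  rewrite cut_edge !inE val_eqE eq_sym [k0 == _]eq_sym (negbTE (valP f)) subr0.
  by rewrite eq_sym.
have c1 (f : {k : K | k != k0}) : cut [set val f] b = b (val f) by rewrite /cut big_set1.
case: (eqVneq x k0) => [->|nx].
  rewrite (eq_bigr (fun f : {k : K | k != k0} => - b (val f))); last first.
    by move=> f _; rewrite c1 /edge eqxx eq_sym (negbTE (valP f)) sub0r mulrN1.
  move: bb; rewrite /balanced (bigD1 k0) //= => /(canRL (addrK _)) ->.
  by rewrite sub0r sumrN (big_sub (fun k => k != k0) b).
rewrite (bigD1 (Sub x nx : {k : K | k != k0})) // c1 /edge SubK eqxx (negbTE nx) subr0 mulr1.
rewrite big1 => [|f nf]; first exact/esym/addr0.
rewrite subr0 eq_sym.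
rewrite (_ : (val f == x) = false) ?mulr0 //; apply: contraNF nf => /eqP fx.
by apply/eqP/val_inj; rewrite SubK.
Qed.

End StarBasis.

(** * Labelled cycles and insertion of points *)

Section CycleInvariants.
Variables (T Z : finType) (s : {perm T}) (h : T -> Z).
Hypothesis hs : forall x, h (s x) = h x.

Lemma invariant_porbit x y : x \in porbit s y -> h x = h y.
Proof.
move=> /porbitP[i ->]; elim: i => [|i IH]; first by rewrite expg0 perm1.
by rewrite expgSr permM hs.
Qed.

Lemma imset_porbits_invariant :
  [set h @: (C : {set T}) | C in porbits s] = set1 @: (h @: T).
Proof.
rewrite /porbits -!imset_comp; apply: eq_imset => x /=; apply/setP => z.
rewrite inE; apply/imsetP/eqP => [[y yx ->]|->]; first exact: invariant_porbit.
by exists x => //; apply: porbit_id.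
Qed.

Lemma card_invariant_le : #|h @: T| <= ncycles s.
Proof.
rewrite -(card_imset _ (@set1_inj Z)) -imset_porbits_invariant.
exact: leq_imset_card.
Qed.

Lemma card_invariant_eq :
  (forall x y, h x = h y -> x \in porbit s y) -> #|h @: T| = ncycles s.
Proof.
move=> sep; rewrite -(card_imset _ (@set1_inj Z)) -imset_porbits_invariant.
apply: card_in_imset => _ _ /imsetP[x _ ->] /imsetP[y _ ->] e; apply/eqP.
rewrite eq_porbit_mem; apply: sep.
have : h x \in h @: porbit s y by rewrite -e imset_f ?porbit_id.
by case/imsetP => z zy ->; apply: invariant_porbit.
Qed.

(** An invariant map takes one value on each cycle; with as many values as cycles, it separates
    them. *)
Lemma invariant_sep : #|h @: T| = ncycles s ->
  forall x y, h x = h y -> x \in porbit s y.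
Proof.
move=> hc x y e.
have /imset_injP inj : #|[set h @: (C : {set T}) | C in porbits s]| == #|porbits s|.
  by rewrite imset_porbits_invariant (card_imset _ (@set1_inj Z)) hc.
rewrite -eq_porbit_mem; apply/eqP/inj; rewrite ?imset_f //.
have hp z : h @: porbit s z = [set h z].
  apply/setP => v; rewrite inE; apply/imsetP/eqP => [[t tz ->]|->].
    exact: invariant_porbit.
  by exists z => //; apply: porbit_id.
by rewrite !hp e.
Qed.

End CycleInvariants.

(** In [tperm y z * s] the point [y] is inserted right after [z]: z goes to y, and y to s z. *)
Lemma invariant_insert (T : finType) (Z : Type) (A : {set T}) (y z : T)
    (s : {perm T}) (h : T -> Z) :
  perm_on A s -> y \notin A -> z \in A -> h y = h z ->
  (forall x, h ((tperm y z * s)%g x) = h x) <-> (forall x, x != y -> h (s x) = h x).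
Proof.
move=> sA yA zA hyz; have yz : y != z by apply: contraNneq yA => ->.
have sy : s y = y by apply: out_perm yA.
split=> e x => [xy|].
  case: (eqVneq x z) => [->|xz]; last by rewrite -(e x) permM tpermD // eq_sym.
  by rewrite -hyz -(e y) permM tpermL.
rewrite permM; case: tpermP => [->|->|/eqP xy /eqP xz].
- by rewrite e // eq_sym.
- by rewrite sy.
- by apply: e.
Qed.

(** * Insertion of a point into labelled cycles *)

Section Labellings.
Local Open Scope ring_scope.
Variables (T : finType) (m n : nat) (S : {set T}) (g : {perm T}) (j0 : 'I_m * 'I_n).
Implicit Types (A : {set T}) (s : {perm T}) (k : {ffun T -> 'I_m * 'I_n}).

(* [k] labels the m cycles of s (first component) and the n cycles of s * g
   (second component) inside A, each cycle meeting S. *)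
Definition labelling A s k : bool :=
  [&& [forall x, (k (s x)).1 == (k x).1],
      [forall x, (k ((s * g)%g x)).2 == (k x).2],
      [forall x, (x \notin A) ==> (k x == j0)],
      [forall i, exists x in S, (k x).1 == i],
      [forall j, exists x in S, (k x).2 == j],
      (ncycles s + #|A| == m + #|T|)%N & (ncycles (s * g)%g + #|A| == n + #|T|)%N].

Definition content A k : {ffun 'I_m * 'I_n -> nat} :=
  [ffun j => #|[set x in A | k x == j]|].

Definition label_sum A (Phi : {ffun 'I_m * 'I_n -> nat} -> rat) : rat :=
  \sum_(s | perm_on A s) \sum_(k | labelling A s k) Phi (content A k).

Definition incr (c : {ffun 'I_m * 'I_n -> nat}) j : {ffun 'I_m * 'I_n -> nat} :=
  [ffun j' => (c j' + (j' == j))%N].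

Variable A : {set T}.
Hypotheses (SA : S \subset A) (gA : perm_on A g).

(** A fixed point [y] outside [S] would be one cycle more than the m labelled ones, all of which
    meet [S]. So a newly added point always lies on an existing cycle. *)
Lemma labelling_fixed y s k : y \notin A -> perm_on A s -> ~~ labelling (y |: A) s k.
Proof.
move=> yA sA; apply/negP => /and5P[/forallP e1 _ _ /forallP sur /and3P[_ /eqP nc _]].
(* An invariant with m values on [A] and one for each point outside, one value more than there are
   cycles. *)
pose h x : 'I_m + T := if x \in A then inl (k x).1 else inr x.
have hs x : h (s x) = h x.
  rewrite /h (perm_closed _ sA); case: ifP => xA; first by rewrite (eqP (e1 x)).
  by rewrite (out_perm sA) ?xA.
have := card_invariant_le hs.
have : (m + #|~: A| <= #|h @: T|)%N.
  pose X : {set 'I_m + T} := [set inl i | i in 'I_m] :|: [set inr x | x in ~: A].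
  have -> : (m + #|~: A| = #|X|)%N.
    rewrite cardsU !card_imset ?card_ord; [|by move=> ? ? []..].
    rewrite (_ : _ :&: _ = set0) ?cards0 ?subn0 //; apply/setP => v; rewrite !inE.
    by apply/negP => /andP[/imsetP[i _ ->] /imsetP[x _]].
  apply/subset_leq_card/subsetP => v; rewrite inE => /orP[/imsetP[i _ ->]|/imsetP[x xA ->]].
    have /existsP[x /andP[xS /eqP <-]] := sur i; apply/imsetP; exists x => //.
    by rewrite /h (subsetP SA).
  by apply/imsetP; exists x => //; rewrite /h; rewrite inE in xA; rewrite (negbTE xA).
move: nc; rewrite cardsU1 yA; have := cardsC A; lia.
Qed.

Definition setk k y v : {ffun T -> 'I_m * 'I_n} := [ffun x => if x == y then v else k x].

(** Since [g] fixes [y], inserting [y] after [z] in [s] also inserts it after [z] in [s * g], so it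
    inherits both labels of [z]. *)
Lemma labelling_insert y z s k : y \notin A -> z \in A -> perm_on A s -> k y = j0 ->
  labelling (y |: A) (tperm y z * s)%g (setk k y (k z)) = labelling A s k.
Proof.
move=> yA zA sA ky; have yz : y != z by apply: contraNneq yA => ->.
have kn x : x != y -> setk k y (k z) x = k x by rewrite ffunE => /negbTE ->.
have ke : setk k y (k z) y = k z by rewrite ffunE eqxx.
have inv (Z : eqType) (p : 'I_m * 'I_n -> Z) t : perm_on A t ->
    [forall x, p (setk k y (k z) ((tperm y z * t)%g x)) == p (setk k y (k z) x)]
    = [forall x, p (k (t x)) == p (k x)].
  move=> tA; have ty : t y = y by apply: out_perm yA.
  have hyz : p (setk k y (k z) y) = p (setk k y (k z) z) by rewrite ke kn // eq_sym.
  have [i1 i2] := @invariant_insert _ _ _ _ _ _ (fun x => p (setk k y (k z) x)) tA yA zA hyz.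
  have tn x : x != y -> t x != y by apply: contra_neq => tx; apply: (@perm_inj _ t); rewrite ty.
  apply/forallP/forallP => e x; apply/eqP.
    case: (eqVneq x y) => [->|xy]; first by rewrite ty.
    by rewrite -(kn _ xy) -(kn _ (tn _ xy)); apply: i1 => // v; apply/eqP/e.
  by apply: i2 => v vy; rewrite !kn ?tn //; apply/eqP/e.
have kS x : x \in S -> setk k y (k z) x = k x.
  by move=> xS; apply: kn; apply: contraNneq yA => <-; apply: (subsetP SA).
rewrite /labelling -mulgA (inv _ fst) // (inv _ snd) ?perm_onM //.
congr [&& _, _, _, _, _, _ & _].
- apply/forallP/forallP => e x; apply/implyP => xA; last first.
    have := e x; rewrite ffunE; move: xA; rewrite !inE negb_or => /andP[/negbTE -> /negbTE ->]; exact.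
  have := e x; rewrite ffunE !inE (negbTE xA) orbF; case: (eqVneq x y) => [->|//]; by rewrite ky.
- apply: eq_forallb => i; apply: eq_existsb => x; case xS: (x \in S) => //=; by rewrite kS.
- apply: eq_forallb => i; apply: eq_existsb => x; case xS: (x \in S) => //=; by rewrite kS.
- by rewrite cardsU1 yA addnS -addSn (ncycles_tperm sA).
- by rewrite cardsU1 yA addnS -addSn (ncycles_tperm (A := A)) // perm_onM.
Qed.

Lemma content_insert y z k : y \notin A -> z \in A ->
  content (y |: A) (setk k y (k z)) = incr (content A k) (k z).
Proof.
move=> yA zA; apply/ffunP => j; rewrite !ffunE.
have -> : [set x in y |: A | setk k y (k z) x == j]
   = [set x in A | k x == j] :|: (if k z == j then [set y] else set0).
  apply/setP => x; rewrite !inE ffunE; case: (eqVneq x y) => [->|xy] /=.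
    by rewrite (negbTE yA) /=; case: ifP => h; rewrite !inE ?eqxx.
  by case: ifP => h; rewrite !inE ?(negbTE xy) orbF.
rewrite [j == _]eq_sym; case: ifP => _; last by rewrite setU0 addn0.
by rewrite setUC cardsU1 inE (negbTE yA) /= addn1 add1n.
Qed.

(** The point [y] can be inserted after any point of [A], and c j of these carry the pair of labels
    j. *)
Lemma label_sum_insert y (Phi : {ffun 'I_m * 'I_n -> nat} -> rat) : y \notin A ->
  label_sum (y |: A) Phi =
  label_sum A (fun c => \sum_j (c j)%:R * Phi (incr c j)).
Proof.
move=> yA; rewrite /label_sum sum_perm_on_setU1 //; apply: eq_bigr => s sA.
rewrite big_pred0 ?add0r => [|k]; last by apply/negbTE/labelling_fixed.
transitivity (\sum_(z in A) \sum_(k | labelling A s k) Phi (incr (content A k) (k z))).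
  apply: eq_bigr => z zA; have yz : y != z by apply: contraNneq yA => ->.
  rewrite (reindex_onto (fun k => setk k y (k z)) (fun k => setk k y j0)) /=.
    apply: eq_big => [k|k _]; last by rewrite content_insert.
    apply/andP/idP => [[l /eqP e]|l].
      have ky : k y = j0 by rewrite -e ffunE eqxx.
      by rewrite labelling_insert in l.
    have ky : k y = j0 by have /and5P[_ _ /forallP/(_ y) + _ _] := l; rewrite yA => /eqP.
    rewrite labelling_insert // l; split=> //; apply/eqP/ffunP => x; rewrite !ffunE.
    by case: eqP => // ->.
  move=> k /and5P[/forallP e1 /forallP e2 _ _ _]; apply/ffunP => x; rewrite !ffunE.
  rewrite eq_sym in yz; rewrite (negbTE yz); case: eqP => // ->.
  have /eqP := e1 z; have /eqP := e2 z.
  rewrite !permM tpermR (out_perm sA yA) (out_perm gA yA).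
  by case: (k z) (k y) => a b [a' b'] /= -> ->.
rewrite exchange_big /=; apply: eq_bigr => k _.
rewrite (partition_big k predT) //=; apply: eq_bigr => j _.
rewrite (eq_bigr (fun _ => Phi (incr (content A k) j))); last by move=> x /andP[_ /eqP ->].
rewrite sumr_const ffunE mulr_natl; congr (_ *+ _).
by apply: eq_card => x; rewrite !inE.
Qed.

End Labellings.

(** * Transport of permutations along an injection *)

Section Transfer.
Variables (U T : finType) (phi : U -> T).
Hypothesis inj : injective phi.
Implicit Types (s : {perm U}).
Let S : {set T} := phi @: U.

Definition preim (t : T) : option U := [pick x | phi x == t].

Lemma preim_phi x : preim (phi x) = Some x.
Proof.
rewrite /preim; case: pickP => [y /eqP /inj -> //|/(_ x)]; by rewrite eqxx.
Qed.

Lemma preim_out t : t \notin S -> preim t = None.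
Proof.
rewrite /preim; case: pickP => // x /eqP <-; by rewrite imset_f.
Qed.

Lemma preim_cases t : (exists x, t = phi x) \/ t \notin S.
Proof.
case: (boolP (t \in S)) => [/imsetP[x _ ->]|]; [by left; exists x|by right].
Qed.

Definition push_fun s t := if preim t is Some x then phi (s x) else t.

Lemma push_fun_inj s : injective (push_fun s).
Proof.
move=> a b; rewrite /push_fun.
case: (preim_cases a) (preim_cases b) => [[x ->]|xS] [[y ->]|yS];
  rewrite ?preim_phi ?preim_out //.
- by move/inj/perm_inj ->.
- by move=> e; rewrite -e imset_f in yS.
- by move=> e; rewrite e imset_f in xS.
Qed.

Definition push s : {perm T} := perm (@push_fun_inj s).

Lemma push_phi s x : push s (phi x) = phi (s x).
Proof. by rewrite permE /push_fun preim_phi. Qed.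

Lemma push_out s t : t \notin S -> push s t = t.
Proof. by move=> tS; rewrite permE /push_fun preim_out. Qed.

Lemma pushM s s' : push (s * s') = (push s * push s')%g.
Proof.
apply/permP => t; rewrite permM; case: (preim_cases t) => [[x ->]|tS].
  by rewrite !push_phi permM.
by rewrite !push_out.
Qed.

Lemma push1 : push 1 = 1%g.
Proof.
apply/permP => t; case: (preim_cases t) => [[x ->]|tS].
  by rewrite push_phi !perm1.
by rewrite push_out ?perm1.
Qed.

Lemma push_prod k (s : 'I_k -> {perm U}) :
  push (\prod_(i < k) s i)%g = (\prod_(i < k) push (s i))%g.
Proof.
elim: k s => [|k IH] s; first by rewrite !big_ord0 push1.
by rewrite !big_ord_recl pushM IH.
Qed.

Lemma push_inj : injective push.
Proof.
move=> s s' e; apply/permP => x; apply: inj; by rewrite -!push_phi e.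
Qed.

Lemma push_on s : perm_on S (push s).
Proof.
apply/subsetP => t; rewrite inE; apply: contraR => tS; by rewrite push_out.
Qed.

(** By counting: there are #|U|! permutations on either side, and [push] is injective. *)
Lemma push_onto (s : {perm T}) : perm_on S s -> exists s', s = push s'.
Proof.
move=> sS; have : s \in [set push s' | s' in {perm U}].
  have -> : [set push s' | s' in {perm U}] = [set s | perm_on S s].
    apply/eqP; rewrite eqEcard; apply/andP; split.
      by apply/subsetP => _ /imsetP[s' _ ->]; rewrite inE push_on.
    rewrite card_imset; last exact: push_inj.
    rewrite cardsE card_perm card_imset // -cardsT -card_perm.
    apply: subset_leq_card; apply/subsetP => s' _.
    by rewrite inE.
  by rewrite inE.
by case/imsetP => s' _ ->; exists s'.
Qed.

Lemma big_push (R : Type) (idx : R) (op : Monoid.com_law idx) (F : {perm T} -> R) :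
  \big[op/idx]_(s | perm_on S s) F s = \big[op/idx]_(s : {perm U}) F (push s).
Proof.
rewrite -(big_imset _ (in2W push_inj)); apply: eq_bigl => s.
apply/idP/imsetP => [/push_onto[s' ->]|[s' _ ->]]; [by exists s'|exact: push_on].
Qed.

Lemma push_moves s x : (push s (phi x) != phi x) = (s x != x).
Proof. by rewrite push_phi (inj_eq inj). Qed.

Lemma ncycles_push s : ncycles (push s) + #|U| = ncycles s + #|T|.
Proof.
pose h t : {set U} + T := if preim t is Some x then inl (porbit s x) else inr t.
have hphi x : h (phi x) = inl (porbit s x) by rewrite /h preim_phi.
have hout t : t \notin S -> h t = inr t by move=> tS; rewrite /h preim_out.
rewrite -(@card_invariant_eq _ _ _ h).
- pose X : {set {set U} + T} := [set inl C | C in porbits s] :|: [set inr t | t in ~: S].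
  have -> : h @: T = X.
    apply/setP => v; apply/imsetP/setUP => [[t _ ->]|[/imsetP[_ /imsetP[x _ ->] ->]|/imsetP[t tS ->]]].
    - case: (preim_cases t) => [[x ->]|tS]; [left|right].
        by rewrite hphi; apply/imset_f/imset_f.
      by rewrite hout //; apply: imset_f; rewrite inE.
    - by exists (phi x).
    - by exists t => //; rewrite hout //; rewrite inE in tS.
  have il : injective (@inl {set U} T) by move=> ? ? [].
  have ir : injective (@inr {set U} T) by move=> ? ? [].
  rewrite cardsU (card_imset _ il) (card_imset _ ir).
  rewrite (_ : _ :&: _ = set0) ?cards0 ?subn0; last first.
    by apply/setP => v; rewrite !inE; apply/negP => /andP[/imsetP[i _ ->] /imsetP[x _]].
  have := cardsC S; rewrite (card_imset _ inj) /ncycles => <-.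
  by rewrite -addnA (addnC #|~: S|).
- move=> t; case: (preim_cases t) => [[x ->]|tS]; last by rewrite push_out.
  by rewrite push_phi !hphi -{2}(expg1 s) porbit_perm.
- move=> a b; case: (preim_cases a) (preim_cases b) => [[x ->]|xS] [[y ->]|yS];
    rewrite ?hphi ?hout //.
    move=> [/eqP]; rewrite eq_porbit_mem => /porbitP[i ->]; apply/porbitP; exists i.
    elim: i => [|i IH]; first by rewrite !expg0 !perm1.
    by rewrite !expgSr !permM -IH push_phi.
  by move=> [->]; apply: porbit_id.
Qed.

Section PushLabels.
Variables (m n : nat) (g : {perm U}) (j0 : 'I_m * 'I_n).

Definition push_label (k : {ffun U -> 'I_m * 'I_n}) : {ffun T -> 'I_m * 'I_n} :=
  [ffun t => if preim t is Some x then k x else j0].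

Lemma label_sum_push (Phi : {ffun 'I_m * 'I_n -> nat} -> rat) :
  label_sum S (push g) j0 S Phi = label_sum setT g j0 setT Phi.
Proof.
rewrite /label_sum big_push.
rewrite [RHS](eq_bigl xpredT) => [|s]; last by apply/subsetP => x; rewrite inE.
apply: eq_bigr => s _.
have kphi k x : push_label k (phi x) = k x by rewrite ffunE preim_phi.
have kout k t : t \notin S -> push_label k t = j0 by move=> tS; rewrite ffunE preim_out.
have kinj : injective push_label.
  by move=> k k' e; apply/ffunP => x; rewrite -!kphi e.
have labE k : labelling S (push g) j0 S (push s) (push_label k) = labelling setT g j0 setT s k.
  have inv (Z : eqType) (p : 'I_m * 'I_n -> Z) t :
     [forall x, p (push_label k (push t x)) == p (push_label k x)] = [forall x, p (k (t x)) == p (k x)].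
    apply/forallP/forallP => e x; first by have := e (phi x); rewrite push_phi !kphi.
    case: (preim_cases x) => [[y ->]|xS]; last by rewrite push_out.
    by rewrite push_phi !kphi.
  have sur (Z : finType) (p : 'I_m * 'I_n -> Z) :
     [forall i, exists x in S, p (push_label k x) == i] = [forall i, exists x in [set: U], p (k x) == i].
    apply: eq_forallb => i; apply/existsP/existsP => -[x /andP[xS e]].
      by case/imsetP: xS e => y _ ->; rewrite kphi => e; exists y; rewrite inE.
    by exists (phi x); rewrite imset_f // kphi.
  rewrite /labelling -pushM (inv _ fst) (inv _ snd) (sur _ fst) (sur _ snd).
  congr [&& _, _, _, _, _, _ & _].
  - rewrite [RHS](_ : _ = true); last by apply/forallP => x; rewrite inE.
    by apply/forallP => x; apply/implyP => xS; rewrite kout.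
  - rewrite card_imset // cardsT; by rewrite ncycles_push !eqn_add2r.
  - rewrite card_imset // cardsT; by rewrite ncycles_push !eqn_add2r.
rewrite (eq_bigl (mem [set push_label k | k in [set k | labelling setT g j0 setT s k]])); last first.
  move=> k; apply/idP/imsetP => [l|[k' + ->]]; last by rewrite inE -labE.
  have e : k = push_label [ffun x => k (phi x)].
    apply/ffunP => t; case: (preim_cases t) => [[x ->]|tS]; first by rewrite kphi ffunE.
    by rewrite kout //; have /and5P[_ _ /forallP/(_ t) + _ _] := l; rewrite tS => /eqP.
  by exists [ffun x => k (phi x)] => //; rewrite inE -labE -e.
rewrite big_imset /=; last by move=> k k' _ _; apply: kinj.
apply: eq_big => k; first by rewrite inE.
move=> _; congr Phi; apply/ffunP => j; rewrite !ffunE -(card_imset _ inj).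
apply: eq_card => t; apply/idP/imsetP; rewrite !inE.
  by move=> /andP[/imsetP[x _ ->]]; rewrite kphi => kj; exists x; rewrite // !inE.
by case=> x; rewrite !inE => /= kj ->; rewrite kphi kj imset_f.
Qed.

End PushLabels.
End Transfer.

(** * Return times to the marked points *)

Section ArcLengths.
Local Open Scope ring_scope.
Variables (N D m n : nat).
Implicit Types (x : {ffun 'I_N -> 'I_D.+1}) (k : {ffun 'I_N -> 'I_m * 'I_n}).
Implicit Types (Phi : {ffun 'I_m * 'I_n -> nat} -> rat).

(** [x i] is the return time of the marked point i: it counts i and the points inserted after it,
    all with the labels of i. *)
Definition arc_content k x : {ffun 'I_m * 'I_n -> nat} :=
  [ffun j => (\sum_(i | k i == j) x i)%N].

Definition arcs (t : nat) x : bool := [forall i, 0 < x i]%N && (\sum_i x i == t)%N.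

Definition arc_sum t k Phi : rat := \sum_(x | arcs t x) Phi (arc_content k x).

Definition bump_arc i x : {ffun 'I_N -> 'I_D.+1} :=
  [ffun j => if j == i then inord (x j).+1 else x j].
Definition drop_arc i x : {ffun 'I_N -> 'I_D.+1} :=
  [ffun j => if j == i then inord (x j).-1 else x j].

Lemma sum_bump_arc (P : pred 'I_N) i x : P i -> (x i < D)%N ->
  (\sum_(j | P j) bump_arc i x j = (\sum_(j | P j) x j).+1)%N.
Proof.
move=> Pi xi; rewrite (bigD1 i) //= [in RHS](bigD1 i) //= ffunE eqxx inordK //.
by rewrite addSn; congr (_ + _).+1%N; apply: eq_bigr => j /andP[_ /negbTE ji]; rewrite ffunE ji.
Qed.

Lemma arc_content_bump i x k : (x i < D)%N ->
  arc_content k (bump_arc i x) = incr (arc_content k x) (k i).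
Proof.
move=> xi; apply/ffunP => j; rewrite !ffunE [j == _]eq_sym; case: eqP => [kj|kj].
  by rewrite sum_bump_arc ?kj // addn1.
rewrite addn0; apply: eq_bigr => i' /eqP ki'; rewrite ffunE.
by case: eqP => // e; case: kj; rewrite -ki' e.
Qed.

Lemma arc_le t x i : arcs t x -> (x i <= t)%N.
Proof. by move=> /andP[_ /eqP <-]; rewrite (bigD1 i) //= leq_addr. Qed.

(** A vector of total t + 1 arises by lengthening arc i from a vector whose i-th entry, its weight,
    is x i - 1; over all i these weights add up to t + 1 - N. *)
Lemma arc_sum_incr t k Phi : (t < D)%N ->
  arc_sum t k (fun c => \sum_j (c j)%:R * Phi (incr c j)) =
  (t.+1%:R - N%:R) * arc_sum t.+1 k Phi.
Proof.
move=> tD; rewrite /arc_sum.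
transitivity (\sum_i \sum_(x | arcs t x) (x i)%:R * Phi (incr (arc_content k x) (k i))).
  rewrite [RHS]exchange_big /=; apply: eq_bigr => x _; rewrite [RHS](partition_big k predT) //=.
  apply: eq_bigr => j _; rewrite ffunE natr_sum mulr_suml; by apply: eq_big => [i|i /eqP <-].
transitivity (\sum_i \sum_(x | arcs t.+1 x) ((x i)%:R - 1) * Phi (arc_content k x)).
  apply: eq_bigr => i _; rewrite [RHS](bigID (fun x : {ffun 'I_N -> 'I_D.+1} => (x i : nat) == 1%N)) /=.
  rewrite [X in _ = X + _]big1 ?add0r; last by move=> x /andP[_ /eqP ->]; rewrite subrr mul0r.
  rewrite [RHS](reindex_onto (bump_arc i) (drop_arc i)) /=; last first.
    move=> x /andP[/andP[xp _] x1]; have x0 := forallP xp i; apply/ffunP => j; rewrite !ffunE.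
    case: eqP => [->|//]; apply: val_inj; rewrite /= !inordK; have := ltn_ord (x i); lia.
  apply: eq_big => [x|x ax]; last first.
    have xi : (x i < D)%N by apply: leq_ltn_trans tD; apply: arc_le.
    by rewrite arc_content_bump // ffunE eqxx inordK // -[in RHS]natr1 addrK.
  apply/idP/idP => [ax|/andP[/andP[ab b1] _]]; last have /andP[/forallP b0 bs] := ab.
    have xi : (x i < D)%N by apply: leq_ltn_trans tD; apply: arc_le.
    case/andP: ax => /forallP x0 xs; rewrite /arcs sum_bump_arc // eqSS xs andbT.
    have bi : (bump_arc i x i = (x i).+1 :> nat) by rewrite ffunE eqxx inordK.
    apply/andP; split; [apply/andP; split|].
    - apply/forallP => j; case: (eqVneq j i) => [->|ji]; first by rewrite bi.
      by rewrite ffunE (negbTE ji).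
    - by rewrite bi eqSS -lt0n x0.
    - apply/eqP/ffunP => j; rewrite !ffunE; case: eqP => // ->; apply: val_inj => /=.
      by rewrite !inordK //= ltnS ?ltnW.
  have xi : (x i < D)%N.
    rewrite ltnNge; apply/negP => Dx; have := b0 i; rewrite ffunE eqxx /inord /insubd insubN //.
    by rewrite ltnS -leqNgt.
  have bi : (bump_arc i x i = (x i).+1 :> nat) by rewrite ffunE eqxx inordK.
  rewrite sum_bump_arc // eqSS in bs; rewrite /arcs bs andbT; apply/forallP => j.
  case: (eqVneq j i) => [->|ji]; first by move: b1; rewrite bi; lia.
  by have := b0 j; rewrite ffunE (negbTE ji).
rewrite exchange_big mulr_sumr /=; apply: eq_bigr => x /andP[_ /eqP <-].
rewrite -mulr_suml sumrB sumr_const card_ord natr_sum //.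
Qed.

Lemma arc_sum_ones k Phi : (0 < D)%N ->
  arc_sum N k Phi = Phi (content setT k).
Proof.
move=> D0; rewrite /arc_sum (big_pred1 [ffun => inord 1]) => [|x].
  congr Phi; apply/ffunP => j; rewrite !ffunE -sum1_card.
  by apply: eq_big => [i|i _]; [rewrite !inE|rewrite ffunE inordK].
apply/andP/eqP => [[/forallP x0 /eqP xs]|->]; last first.
  split; first by apply/forallP => i; rewrite ffunE inordK.
  under eq_bigr => i _ do rewrite ffunE inordK //.
  by rewrite sum1_card card_ord.
have : (\sum_i (x i - 1) == 0)%N.
  by rewrite sumnB // xs sum1_card card_ord subnn.
rewrite sum_nat_eq0 => /forallP h; apply/ffunP => i; rewrite ffunE; apply: val_inj.
by rewrite /= inordK //; have := h i; have := x0 i => /=; lia.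
Qed.

Variables (g : 'S_N) (j0 : 'I_m * 'I_n).

Definition skeleton_sum t Phi : rat :=
  \sum_(s : 'S_N) \sum_(k | labelling setT g j0 setT s k) arc_sum t k Phi.

Variables (T : finType) (phi : 'I_N -> T).
Hypothesis inj : injective phi.

(* A new point can be inserted into an arc of length l in l ways, and lengthens
   it by one; iterating this produces the factorial. *)
Lemma label_sum_skeleton (A : {set T}) Phi : phi @: 'I_N \subset A -> (0 < D)%N -> (#|A| <= D)%N ->
  label_sum (phi @: 'I_N) (push inj g) j0 A Phi = (#|A| - N)`!%:R * skeleton_sum #|A| Phi.
Proof.
set S := phi @: 'I_N; have cS : #|S| = N by rewrite card_imset // card_ord.
have [c] := ubnP #|A|; elim: c A Phi => // c IH A Phi; rewrite ltnS => Ac SA D0 AD.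
case: (eqVneq S A) => [<-|nSA].
  rewrite cS subnn fact0 mul1r label_sum_push /label_sum /skeleton_sum.
  apply: eq_big => [s|s _]; first by apply/subsetP => x; rewrite inE.
  by apply: eq_bigr => k _; rewrite arc_sum_ones.
have /properP[_ [y yA yS]] : S \proper A by rewrite properEneq nSA.
have gA : perm_on (A :\ y) (push inj g).
  apply: subset_trans (push_on inj g) _; apply/subsetP => x xS; rewrite !inE (subsetP SA) // andbT.
  by apply: contraNneq yS => <-.
have SA' : S \subset A :\ y.
  by apply/subsetP => x xS; rewrite !inE (subsetP SA) // andbT; apply: contraNneq yS => <-.
have cA : #|A| = #|A :\ y|.+1 by rewrite (cardsD1 y A) yA.
rewrite -{1}(setD1K yA) label_sum_insert ?setD11 // IH //; [|lia..].
have NA : (N <= #|A :\ y|)%N by rewrite -cS subset_leq_card.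
rewrite cA subSn // factS natrM [_.+1%:R * _]mulrC -mulrA; congr (_ * _).
rewrite /skeleton_sum mulr_sumr; apply: eq_bigr => s _.
rewrite mulr_sumr; apply: eq_bigr => k _; rewrite arc_sum_incr; last by lia.
by rewrite -subSn // natrB // ltnW.
Qed.

End ArcLengths.

(** * Counting mixed factorisations *)

Section OneSide.
Variables (d m : nat) (s : 'S_d) (mu : m.-tuple nat).

(** A labelling of cycles encoded as a map on points, the form in which [labelling] pairs the labels
    of two permutations. *)
Definition cycle_map (k : {ffun 'I_d -> 'I_m}) : bool :=
  [&& [forall x, k (s x) == k x], [forall i, exists x, k x == i],
      ncycles s == m & [forall i, #|[set x | k x == i]| == tnth mu i]].

Definition fibres (k : {ffun 'I_d -> 'I_m}) : {ffun 'I_m -> {set 'I_d}} :=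
  [ffun i => [set x | k x == i]].

Lemma fibres_inj : injective fibres.
Proof.
move=> k k' /ffunP e; apply/ffunP => x; have /setP/(_ x) := e (k x).
by rewrite !ffunE !inE eqxx => /esym/eqP.
Qed.

Lemma cycle_map_image k : cycle_map k -> #|k @: 'I_d| = m.
Proof.
move=> /and4P[_ /forallP sur _ _]; rewrite -[RHS]card_ord; apply: eq_card => i.
by rewrite !inE; have /existsP[x /eqP <-] := sur i; apply: imset_f.
Qed.

Lemma cycle_map_fibre k x : cycle_map k -> [set y | k y == k x] = porbit s x.
Proof.
move=> ck; have /and4P[/forallP inv _ /eqP ns _] := ck.
have hs y : k (s y) = k y by apply/eqP.
apply/setP => y; rewrite inE; apply/eqP/idP.
  by apply: (invariant_sep hs); rewrite cycle_map_image // ns.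
by move/(invariant_porbit hs).
Qed.

Lemma labelling_cycle_type l : is_cycle_labelling s mu l -> has_cycle_type s mu.
Proof.
case/and3P => /injectiveP li /eqP lp /forallP lc; rewrite /has_cycle_type -lp.
have -> : tval mu = [seq #|l i| | i <- enum 'I_m].
  rewrite -[LHS](map_tnth_enum mu); apply: eq_map => i; exact/esym/eqP/lc.
have -> : [seq #|l i| | i <- enum 'I_m] = [seq #|C| | C : {set 'I_d} <- [seq l i | i <- enum 'I_m]].
  by rewrite -map_comp.
apply: perm_map; apply: uniq_perm; rewrite ?enum_uniq // ?(map_inj_uniq li) ?enum_uniq //.
move=> C; rewrite mem_enum; apply/imsetP/mapP => -[i _ ->]; exists i; rewrite ?mem_enum //.
Qed.

Lemma cycle_labellingE l :
  has_cycle_type s mu && is_cycle_labelling s mu l = (l \in [set fibres k | k in [set k | cycle_map k]]).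
Proof.
apply/andP/imsetP => [[_ /and3P[/injectiveP li /eqP lp /forallP lc]]|[k + ->]]; last first.
  rewrite inE => ck; have /and4P[/forallP inv /forallP sur /eqP ns /forallP cc] := ck.
  suff h : is_cycle_labelling s mu (fibres k) by split=> //; apply: labelling_cycle_type h.
  apply/and3P; split.
  - apply/injectiveP => i j; rewrite !ffunE => /setP e.
    have /existsP[x /eqP xi] := sur i; have := e x.
    by rewrite !inE xi eqxx => /esym/eqP.
  - apply/eqP/setP => C; apply/imsetP/imsetP => [[i _ ->]|[x _ ->]].
      by have /existsP[x /eqP <-] := sur i; exists x; rewrite // ffunE cycle_map_fibre.
    by exists (k x); rewrite // ffunE cycle_map_fibre.
  - by apply/forallP => i; rewrite ffunE.
have ex x : exists i, x \in l i.
  have : porbit s x \in [set l i | i : 'I_m] by rewrite lp imset_f.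
  by case/imsetP => i _ e; exists i; rewrite -e porbit_id.
have orb i x : x \in l i -> l i = porbit s x.
  have : l i \in porbits s by rewrite -lp imset_f.
  case/imsetP => y _ ->; by rewrite -eq_porbit_mem => /eqP.
have [k hk] := fin_all_exists ex.
have uq x i : x \in l i -> k x = i by move=> xi; apply: li; rewrite (orb _ _ xi) (orb _ _ (hk x)).
have le : l = fibres [ffun x => k x].
  apply/ffunP => i; rewrite ffunE; apply/setP => x; rewrite inE ffunE; apply/idP/eqP; first exact: uq.
  by move=> <-.
exists [ffun x => k x] => //; rewrite inE; apply/and4P; split.
- apply/forallP => x; rewrite !ffunE; apply/eqP; apply: uq.
  by rewrite (orb _ _ (hk x)) -{1}(expg1 s) mem_porbit.
- apply/forallP => i; have : l i \in porbits s by rewrite -lp imset_f.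
  case/imsetP => x _ e; apply/existsP; exists x; rewrite ffunE; apply/eqP/uq.
  by rewrite e porbit_id.
- by rewrite /ncycles -lp card_imset // card_ord.
- apply/forallP => i; have := lc i; rewrite {1}le ffunE //.
Qed.

Lemma card_cycle_labelling :
  #|[set l | has_cycle_type s mu && is_cycle_labelling s mu l]| = #|[set k | cycle_map k]|.
Proof.
rewrite -[RHS](card_imset _ fibres_inj); apply: eq_card => l.
by rewrite inE cycle_labellingE.
Qed.

End OneSide.

Lemma cycle_labellingV d m (s : 'S_d) (mu : m.-tuple nat) l :
  has_cycle_type s^-1 mu && is_cycle_labelling s^-1 mu l
  = has_cycle_type s mu && is_cycle_labelling s mu l.
Proof. by rewrite /has_cycle_type /is_cycle_labelling porbitsV. Qed.

Section Count.
Local Open Scope ring_scope.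
Variables (d m n : nat) (mu : m.-tuple nat) (nu : n.-tuple nat) (j0 : 'I_m * 'I_n).

Definition margins (c : {ffun 'I_m * 'I_n -> nat}) : rat :=
  ([forall i, \sum_j c (i, j) == tnth mu i] && [forall j, \sum_i c (i, j) == tnth nu j])%N%:R.

(** The number of choices of sigma_1 and of both labellings once the transpositions have product
    [g]; this is [weightE]. *)
Definition weight (g : 'S_d) : rat := label_sum setT g j0 setT margins.

Lemma content_margin1 (k : {ffun 'I_d -> 'I_m * 'I_n}) i :
  (\sum_j content setT k (i, j) = #|[set x | (k x).1 == i]|)%N.
Proof.
rewrite -sum1dep_card (partition_big (fun x => (k x).2) predT) //=.
apply: eq_bigr => j _; rewrite ffunE -sum1dep_card; apply: eq_bigl => x.
by rewrite inE; case: (k x) => a b /=; rewrite xpair_eqE.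
Qed.

Lemma content_margin2 (k : {ffun 'I_d -> 'I_m * 'I_n}) j :
  (\sum_i content setT k (i, j) = #|[set x | (k x).2 == j]|)%N.
Proof.
rewrite -sum1dep_card (partition_big (fun x => (k x).1) predT) //=.
apply: eq_bigr => i _; rewrite ffunE -sum1dep_card; apply: eq_bigl => x.
by rewrite inE; case: (k x) => a b /=; rewrite xpair_eqE andbC.
Qed.

Definition pair_map (z : {ffun 'I_d -> 'I_m} * {ffun 'I_d -> 'I_n}) : {ffun 'I_d -> 'I_m * 'I_n} :=
  [ffun x => (z.1 x, z.2 x)].

Lemma pair_map_labelling (s g : 'S_d) k1 k2 :
  labelling setT g j0 setT s (pair_map (k1, k2)) && (margins (content setT (pair_map (k1, k2))) != 0)
  = cycle_map s mu k1 && cycle_map (s * g)%g nu k2.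
Proof.
rewrite /margins pnatr_eq0 eqb0 negbK.
under eq_forallb => i do rewrite content_margin1.
under [X in _ && (_ && X)]eq_forallb => j do rewrite content_margin2.
rewrite /labelling /cycle_map.
have f1 i : [set x | (pair_map (k1, k2) x).1 == i] = [set x | k1 x == i].
  by apply/setP => x; rewrite !inE ffunE.
have f2 i : [set x | (pair_map (k1, k2) x).2 == i] = [set x | k2 x == i].
  by apply/setP => x; rewrite !inE ffunE.
under [X in _ && (X && _)]eq_forallb => i do rewrite f1.
under [X in _ && (_ && X)]eq_forallb => i do rewrite f2.
have -> : [forall x, (pair_map (k1, k2) (s x)).1 == (pair_map (k1, k2) x).1] = [forall x, k1 (s x) == k1 x].
  by apply: eq_forallb => x; rewrite !ffunE.
have -> : [forall x, (pair_map (k1, k2) ((s * g)%g x)).2 == (pair_map (k1, k2) x).2] = [forall x, k2 ((s * g)%g x) == k2 x].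
  by apply: eq_forallb => x; rewrite !ffunE.
have -> : [forall x, (x \notin [set: 'I_d]) ==> (pair_map (k1, k2) x == j0)] = true.
  by apply/forallP => x; rewrite inE.
have -> : [forall i, exists x in [set: 'I_d], (pair_map (k1, k2) x).1 == i] = [forall i, exists x, k1 x == i].
  by apply: eq_forallb => i; apply: eq_existsb => x; rewrite inE ffunE.
have -> : [forall i, exists x in [set: 'I_d], (pair_map (k1, k2) x).2 == i] = [forall i, exists x, k2 x == i].
  by apply: eq_forallb => i; apply: eq_existsb => x; rewrite inE ffunE.
rewrite cardsT !eqn_add2r.
move: [forall x, k1 (s x) == k1 x] [forall x, k2 ((s * g)%g x) == k2 x] [forall i, exists x, k1 x == i]
  [forall i, exists x, k2 x == i] (ncycles s == m) (ncycles (s * g)%g == n) => a b c e f h.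
move: [forall i, _] [forall j, _] => u v.
by case: a b c e f h u v => [] [] [] [] [] [] [] [].
Qed.

Lemma weightE (g : 'S_d) :
  weight g = \sum_(s : 'S_d) (#|[set k | cycle_map s mu k]| * #|[set k | cycle_map (s * g)%g nu k]|)%:R.
Proof.
rewrite /weight /label_sum; apply: eq_big => [s|s _]; first by apply/subsetP => x; rewrite inE.
rewrite (reindex pair_map) /=; last first.
  exists (fun k => ([ffun x => (k x).1], [ffun x => (k x).2])) => [[k1 k2]|k] _.
    by congr pair; apply/ffunP => x; rewrite !ffunE.
  by apply/ffunP => x; rewrite !ffunE /=; case: (k x).
rewrite -cardsX -sum1_card natr_sum.
rewrite big_mkcond [RHS]big_mkcond /=; apply: eq_bigr => -[k1 k2] _.
rewrite in_setX !inE -pair_map_labelling.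
case: (labelling _ _ _ _ _ _) => //=; case: eqP => [->//|]; rewrite /margins.
by case: (_ && _).
Qed.

(** The permutation sigma_2 is determined as the inverse of sigma_1 times the product of the
    transpositions, and inverse permutations have the same cycles. *)
Lemma card_mixed_factorisations p q r :
  #|mixed_factorisations d p q r mu nu|%:R =
  \sum_(tau : {ffun 'I_(p + q + r) -> 'S_d} | mixed_monotone tau) weight (\prod_i tau i)%g.
Proof.
pose A (s : 'S_d) := #|[set l | has_cycle_type s mu && is_cycle_labelling s mu l]|.
pose B (s : 'S_d) := #|[set l | has_cycle_type s nu && is_cycle_labelling s nu l]|.
transitivity (\sum_(tau : {ffun 'I_(p + q + r) -> 'S_d} | mixed_monotone tau)
    \sum_(s : 'S_d) (A s * B (s * \prod_i tau i)%g)%:R : rat); last first.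
  apply: eq_bigr => tau _; rewrite weightE; apply: eq_bigr => s _.
  by rewrite /A /B !card_cycle_labelling.
rewrite exchange_big /= -sum1_card natr_sum.
pose F (s1 : 'S_d) (l1 : {ffun 'I_m -> {set 'I_d}}) (tau : {ffun 'I_(p + q + r) -> 'S_d})
  (s2 : 'S_d) (l2 : {ffun 'I_n -> {set 'I_d}}) : rat :=
  (is_mixed_factorisation mu nu s1 l1 tau s2 l2)%:R.
transitivity (\sum_s1 \sum_l1 \sum_tau \sum_s2 \sum_l2 F s1 l1 tau s2 l2).
  rewrite (pair_bigA _ (fun s1 l1 => \sum_tau \sum_s2 \sum_l2 F s1 l1 tau s2 l2)) /=.
  rewrite (pair_bigA _ (fun a tau => \sum_s2 \sum_l2 F a.1 a.2 tau s2 l2)) /=.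
  rewrite (pair_bigA _ (fun a s2 => \sum_l2 F a.1.1 a.1.2 a.2 s2 l2)) /=.
  rewrite (pair_bigA _ (fun a l2 => F a.1.1.1 a.1.1.2 a.1.2 a.2 l2)) /=.
  rewrite big_mkcond; apply: eq_bigr => -[[[[s1 l1] tau] s2] l2] _; rewrite inE /F /=.
  by case: (is_mixed_factorisation _ _ _ _ _ _ _).
apply: eq_bigr => s1 _; rewrite exchange_big /= [RHS]big_mkcond; apply: eq_bigr => tau _.
transitivity (\sum_l1 \sum_l2 F s1 l1 tau (s1 * \prod_i tau i)^-1%g l2).
  apply: eq_bigr => l1 _; rewrite (bigD1 (s1 * \prod_i tau i)^-1%g) //= [X in _ + X]big1 ?addr0 //.
  move=> s2 ne; apply: big1 => l2 _; rewrite /F /is_mixed_factorisation.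
  by rewrite -eq_invg_mul eq_sym (negbTE ne).
have E l1 l2 : is_mixed_factorisation mu nu s1 l1 tau (s1 * \prod_i tau i)^-1%g l2
  = [&& mixed_monotone tau, has_cycle_type s1 mu && is_cycle_labelling s1 mu l1
      & has_cycle_type (s1 * \prod_i tau i)%g nu && is_cycle_labelling (s1 * \prod_i tau i)%g nu l2].
  rewrite /is_mixed_factorisation mulgV eqxx /= -(cycle_labellingV (s1 * _)%g nu).
  by case: (has_cycle_type _ _); case: (has_cycle_type _ _); case: (mixed_monotone _);
     case: (is_cycle_labelling _ _ _); case: (is_cycle_labelling _ _ _).
rewrite /F; case: ifP => mm; last first.
  by rewrite big1 // => l1 _; rewrite big1 // => l2 _; rewrite E mm.
rewrite /A /B -cardsX -sum1_card natr_sum.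
rewrite (pair_bigA _ (fun l1 l2 => (is_mixed_factorisation mu nu s1 l1 tau (s1 * \prod_i tau i)^-1%g l2)%:R)) /=.
rewrite [RHS]big_mkcond; apply: eq_bigr => -[l1 l2] _; rewrite in_setX !inE E mm /=.
by case: (_ && _).
Qed.

End Count.

(** * Marked points and supports of tuples of permutations *)

Lemma eq_porbit_on (T : finType) (s t : {perm T}) x0 :
  (forall x, x \in porbit s x0 -> t x = s x) -> porbit t x0 = porbit s x0.
Proof.
move=> h; have e i : ((t ^+ i) x0 = (s ^+ i) x0)%g.
  elim: i => [|i IH]; first by rewrite !expg0.
  by rewrite !expgSr !permM IH h // mem_porbit.
by apply/setP => y; apply/porbitP/porbitP => -[i ->]; exists i; rewrite e.
Qed.

Section Marked.
Local Open Scope ring_scope.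
Variables (d m n : nat) (mu : m.-tuple nat) (nu : n.-tuple nat) (j0 : 'I_m * 'I_n).
Variables (S : {set 'I_d}) (g : 'S_d).
Hypotheses (gS : perm_on S g) (S0 : S != set0).
Hypothesis nowall : forall i j, tnth mu i = tnth nu j -> m = 1%N /\ n = 1%N.

(** A cycle without points of [S] is common to [s] and [s * g], so a part of mu equals a part of nu.
    This leaves m = n = 1, where any point of [S] carries the only label. *)
Lemma marked_cycles s k1 k2 : cycle_map s mu k1 -> cycle_map (s * g)%g nu k2 ->
  (forall i, exists2 x, x \in S & k1 x = i) /\ (forall j, exists2 x, x \in S & k2 x = j).
Proof.
move=> c1 c2.
have [/forallP i1 /forallP s1 _ /forallP n1] := and4P c1.
have [/forallP i2 /forallP s2 _ /forallP n2] := and4P c2.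
have key x0 : porbit (s * g)%g x0 = porbit s x0 -> m = 1%N /\ n = 1%N.
  move=> e; apply: (@nowall (k1 x0) (k2 x0)).
  by rewrite -(eqP (n1 _)) -(eqP (n2 _)) (cycle_map_fibre x0 c1) (cycle_map_fibre x0 c2) e.
have [v vS] := set0Pn _ S0.
split=> [i|j].
  have /existsP[x0 /eqP xi] := s1 i.
  case: (boolP [exists x in S, k1 x == i]) => [/existsP[x /andP[xS /eqP e]]|].
    by exists x.
  rewrite negb_exists => /forallP nS.
  have [] := key x0; last first.
    by move=> m1 _; exists v => //; apply/val_inj; move: m1 (ltn_ord (k1 v)) (ltn_ord i) => /=; lia.
  apply: eq_porbit_on => x; rewrite -(cycle_map_fibre x0 c1) inE xi => /eqP kx.
  rewrite permM (out_perm gS) //; have := nS (s x); rewrite negb_and => /orP[//|].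
  by rewrite (eqP (i1 x)) kx eqxx.
have /existsP[x0 /eqP xj] := s2 j.
case: (boolP [exists x in S, k2 x == j]) => [/existsP[x /andP[xS /eqP e]]|].
  by exists x.
rewrite negb_exists => /forallP nS.
have [] := key x0; last first.
  by move=> _ n1'; exists v => //; apply/val_inj; move: n1' (ltn_ord (k2 v)) (ltn_ord j) => /=; lia.
apply/esym/eq_porbit_on => x; rewrite -(cycle_map_fibre x0 c2) inE xj => /eqP kx.
rewrite permM (out_perm gS) //; have := nS ((s * g)%g x); rewrite negb_and => /orP[|].
  by rewrite permM (perm_closed _ gS).
by rewrite (eqP (i2 x)) kx eqxx.
Qed.

Lemma weight_marked : weight mu nu j0 g = label_sum S g j0 setT (margins mu nu).
Proof.
apply: eq_bigr => s _; rewrite big_mkcond [RHS]big_mkcond; apply: eq_bigr => k _.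
case: (eqVneq (margins mu nu (content setT k)) 0) => [->|nz]; first by rewrite !if_same.
congr (if _ then _ else _); apply/idP/idP => [l|].
  have e : k = pair_map ([ffun x => (k x).1], [ffun x => (k x).2]).
    by apply/ffunP => x; rewrite !ffunE; case: (k x).
  have := pair_map_labelling mu nu j0 s g [ffun x => (k x).1] [ffun x => (k x).2].
  rewrite -e nz l => /esym/andP[c1 c2]; have [h1 h2] := marked_cycles c1 c2.
  case/and5P: l => l1 l2 l3 l4 /and3P[l5 l6 l7]; apply/and5P; split=> //.
    by apply/forallP => i; have [x xS] := h1 i; rewrite ffunE => e1; apply/existsP; exists x; rewrite xS e1 eqxx.
  apply/and3P; split=> //.
  by apply/forallP => i; have [x xS] := h2 i; rewrite ffunE => e1; apply/existsP; exists x; rewrite xS e1 eqxx.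
case/and5P => l1 l2 l3 /forallP l4 /and3P[/forallP l5 l6 l7]; apply/and5P; split=> //.
  by apply/forallP => i; have /existsP[x /andP[_ e]] := l4 i; apply/existsP; exists x; rewrite inE e.
apply/and3P; split=> //.
by apply/forallP => i; have /existsP[x /andP[_ e]] := l5 i; apply/existsP; exists x; rewrite inE e.
Qed.

End Marked.

(** Splitting a moved point off its cycle by a transposition gives one more cycle and fixes at least
    one and at most two moved points. *)
Lemma card_moved (T : finType) (s : {perm T}) :
  #|[set x | s x != x]| + 2 * ncycles s <= 2 * #|T|.
Proof.
have [c] := ubnP #|[set x | s x != x]|; elim: c s => // c IH s; rewrite ltnS => hc.
case: (set_0Vmem [set x | s x != x]) => [->|[x]].
  by rewrite cards0 add0n leq_mul2l ncycles_le.
rewrite inE => sx; set y := s x; pose u := (tperm x y * s)%g.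
have xy : x != y by rewrite eq_sym.
have nu_ : ncycles u = (ncycles s).+1.
  have yx : x \in porbit s y by rewrite porbit_sym; apply/porbitP; exists 1; rewrite expg1.
  have := porbits_mul_tperm s x y; rewrite xy yx /=.
  by rewrite addn0 addn1.
have uy : u y = y by rewrite permM tpermR.
have un z : z != x -> z != y -> u z = s z by move=> zx zy; rewrite permM tpermD // eq_sym.
have sub : [set z | s z != z] \subset x |: (y |: [set z | u z != z]).
  apply/subsetP => z; rewrite !inE => sz; case: (eqVneq z x) => //= zx; case: (eqVneq z y) => //= zy.
  by rewrite un.
have sub2 : [set z | u z != z] \subset [set z | s z != z] :\ y.
  apply/subsetP => z; rewrite !inE; case: (eqVneq z y) => [->|zy]; first by rewrite uy eqxx.
  case: (eqVneq z x) => [->|zx]; first by rewrite sx.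
  by rewrite un.
have ys : y \in [set z | s z != z] by rewrite inE (inj_eq perm_inj).
have c2 := subset_leq_card sub2; have cD := cardsD1 y [set z | s z != z].
rewrite ys /= in cD.
have c1 := subset_leq_card sub; rewrite !cardsU1 in c1.
have := IH u; rewrite nu_ => /(_ ltac:(lia)); move: c1.
by case: (_ \notin _); case: (_ \notin _) => /=; lia.
Qed.

Section Supports.
Local Open Scope ring_scope.
Variables (w : seq nat).

Definition factors N (pi : {ffun 'I_(size w) -> 'S_N}) : bool :=
  [forall j, ncycles (pi j) + nth 0 w j == N]%N.

Definition joint_supp N (pi : {ffun 'I_(size w) -> 'S_N}) : {set 'I_N} :=
  [set x | [exists j, pi j x != x]].

Lemma joint_supp_on N (pi : {ffun 'I_(size w) -> 'S_N}) j : perm_on (joint_supp pi) (pi j).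
Proof. by apply/subsetP => x; rewrite !inE => h; apply/existsP; exists j. Qed.

Lemma card_joint_supp N (pi : {ffun 'I_(size w) -> 'S_N}) :
  factors pi -> (#|joint_supp pi| <= 2 * sumn w)%N.
Proof.
move/forallP => h.
have -> : joint_supp pi = \bigcup_j [set x | pi j x != x].
  apply/setP => x; rewrite inE; apply/existsP/bigcupP => [[j xj]|[j _]].
    by exists j; rewrite ?inE.
  by rewrite inE => xj; exists j.
apply: leq_trans (_ : \sum_(j < size w) 2 * nth 0 w j <= _)%N; last first.
  by rewrite -big_distrr leq_mul2l /= sumnE (big_nth 0%N) big_mkord.
elim/big_ind2: _ => [|A a B b hA hB|j _]; first by rewrite cards0.
  by rewrite (leq_trans _ (leq_add hA hB)) // cardsU leq_subr.
have := card_moved (pi j); have := h j; rewrite card_ord; lia.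
Qed.

Lemma elems_ffun d (f : 'S_d -> rat) g :
  elems w f g = \sum_(pi : {ffun 'I_(size w) -> 'S_d} | factors pi) f (g * \prod_j pi j)%g.
Proof.
rewrite /factors; elim: (w) g => [|r v IH] g /=.
  rewrite (big_pred1 [ffun _ : 'I_0 => 1%g]) ?big_ord0 ?mulg1 // => pi.
  have -> : pi = [ffun _ : 'I_0 => 1%g] by apply/ffunP => -[].
  by rewrite /= eqxx; apply/forallP => -[].
rewrite big_fcons /= /elem big_mkcond /=; apply: eq_bigr => s _.
have E (pi : {ffun 'I_(size v) -> 'S_d}) :
   [forall j, ncycles (fcons s pi j) + nth 0 (r :: v) j == d]%N =
   (ncycles s + r == d)%N && [forall j, ncycles (pi j) + nth 0 v j == d]%N.
  rewrite forall_ordS fcons0; congr (_ && _); apply: eq_forallb => j; by rewrite fconsS.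
have -> : perm_on [set: 'I_d] s by apply/subsetP => x; rewrite inE.
rewrite card_ord /=; case: ifP => h; last by rewrite big_pred0 // => pi; rewrite E h.
rewrite IH; apply: eq_big => [pi|pi _]; first by rewrite E h.
rewrite big_ord_recl fcons0 mulgA; congr (f (_ * _)%g).
by apply: eq_bigr => j _; rewrite fconsS.
Qed.

(** Renumbers the joint support [S] by its elements, so that the tuples range over a set depending
    only on #|S|. *)
Lemma sum_joint_supp d (S : {set 'I_d}) (F : {ffun 'I_(size w) -> 'S_d} -> rat) :
  \sum_(pi | factors pi && (joint_supp pi == S)) F pi =
  \sum_(pi : {ffun 'I_(size w) -> 'S_#|S|} | factors pi && (joint_supp pi == setT))
    F [ffun j => push (@enum_val_inj _ S) (pi j)].
Proof.
set inj := @enum_val_inj _ _.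
have im : enum_val @: 'I_#|S| = S.
  apply/setP => x; apply/imsetP/idP => [[i _ ->]|xS]; first exact: enum_valP.
  by exists (enum_rank_in xS x); rewrite // enum_rankK_in.
pose h (pi : {ffun 'I_(size w) -> 'S_#|S|}) : {ffun 'I_(size w) -> 'S_d} := [ffun j => push inj (pi j)].
have hinj : injective h.
  by move=> p p' /ffunP e; apply/ffunP => j; have := e j; rewrite !ffunE => /push_inj.
have hf pi : factors (h pi) = factors pi.
  apply: eq_forallb => j; rewrite ffunE -(eqn_add2r #|'I_#|S| |) addnAC ncycles_push !card_ord.
  by rewrite addnAC (addnC d) eqn_add2r.
have hs pi : joint_supp (h pi) = enum_val @: joint_supp pi.
  apply/setP => x; apply/idP/imsetP => [|[y]]; rewrite !inE.
    case/existsP => j; rewrite ffunE.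
    have [[y ->]|xS] := preim_cases (enum_val : 'I_#|S| -> _) x; last by rewrite push_out // eqxx.
    by rewrite push_moves => yj; exists y => //; rewrite inE; apply/existsP; exists j.
  by case/existsP => j yj ->; apply/existsP; exists j; rewrite ffunE push_moves.
have hS pi : (joint_supp (h pi) == S) = (joint_supp pi == setT).
  rewrite hs; apply/eqP/eqP => [e|->]; last first.
    by rewrite -[RHS]im; apply/setP => x; apply/imsetP/imsetP => -[y _ ->]; exists y.
  apply/setP => y; rewrite [RHS]in_setT.
  have : enum_val y \in enum_val @: joint_supp pi by rewrite e enum_valP.
  by case/imsetP => z zpi /inj e2; rewrite e2.
rewrite (eq_bigl (mem (h @: [set pi | factors pi && (joint_supp pi == setT)]))); last first.
  move=> pi; apply/idP/imsetP => [/andP[fp sp]|[pi' + ->]]; last by rewrite inE hf hS.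
  have [pi' hpi'] : exists pi' : 'I_(size w) -> 'S_#|S|, forall j, pi j = push inj (pi' j).
    apply: (@fin_all_exists _ (fun _ => 'S_#|S|) (fun j s => pi j = push inj s)) => j.
    by apply: push_onto; rewrite im -(eqP sp) joint_supp_on.
  have e : pi = h [ffun j => pi' j] by apply/ffunP => j; rewrite !ffunE hpi'.
  by exists [ffun j => pi' j] => //; rewrite inE -hf -hS -e fp sp.
rewrite big_imset /=; last by move=> ? ? _ _; apply: hinj.
by apply: eq_bigl => pi; rewrite inE.
Qed.

Hypothesis w_pos : all (leq 1) w.
Hypothesis w_nil : (0 < size w)%N.

Lemma joint_supp_n0 N (pi : {ffun 'I_(size w) -> 'S_N}) : factors pi -> joint_supp pi != set0.
Proof.
move=> /forallP h; apply/negP => /eqP e; have := h (Ordinal w_nil).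
have -> : pi (Ordinal w_nil) = 1%g.
  apply/permP => x; have := joint_supp_on pi (Ordinal w_nil); rewrite e => /out_perm ->; by rewrite ?inE ?perm1.
rewrite ncycles1 card_ord /=; have /allP/(_ (nth 0%N w 0)) := w_pos.
by rewrite mem_nth // => /(_ isT); lia.
Qed.

Variables (m n : nat) (mu : m.-tuple nat) (nu : n.-tuple nat) (j0 : 'I_m * 'I_n).
Variable d : nat.
Hypothesis nowall : forall i j, tnth mu i = tnth nu j -> m = 1%N /\ n = 1%N.
Hypothesis d0 : (0 < d)%N.

Definition skeletons N : rat :=
  \sum_(pi : {ffun 'I_(size w) -> 'S_N} | factors pi && (joint_supp pi == setT))
    skeleton_sum d (\prod_j pi j)%g j0 d (margins mu nu).

(** There are binomial(d, N) supports of size N, each leaving (d - N)! ways to insert the other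
    points. Terms with N > d or N > 2 [sumn w] vanish, so the range of N can be made independent of
    d. *)
Lemma elems_weight :
  elems w (weight mu nu j0) (1%g : 'S_d) = d`!%:R * \sum_(N < (2 * sumn w).+1) skeletons N / N`!%:R.
Proof.
rewrite elems_ffun (partition_big (@joint_supp d) predT) //=.
transitivity (\sum_(S : {set 'I_d}) (d - #|S|)`!%:R * skeletons #|S|).
  apply: eq_bigr => S _; rewrite sum_joint_supp /skeletons mulr_sumr; apply: eq_bigr => pi /andP[fp sp].
  rewrite mul1g (eq_bigr (fun j => push (@enum_val_inj _ S) (pi j))); last by move=> j _; rewrite ffunE.
  rewrite -push_prod.
  have im : enum_val @: 'I_#|S| = S.
    apply/setP => x; apply/imsetP/idP => [[i _ ->]|xS]; first exact: enum_valP.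
    by exists (enum_rank_in xS x); rewrite // enum_rankK_in.
  have S0 : S != set0.
    have := joint_supp_n0 fp; rewrite (eqP sp) -!card_gt0 cardsT card_ord //.
  rewrite (@weight_marked _ _ _ _ _ _ (enum_val @: 'I_#|S|)) //; [|by apply: push_on|by rewrite im].
  by rewrite (@label_sum_skeleton _ d) ?cardsT ?card_ord // subsetT.
rewrite (partition_big (fun S : {set 'I_d} => inord #|S| : 'I_d.+1) predT) //=.
transitivity (\sum_(N < d.+1) d`!%:R * (skeletons N / N`!%:R)).
  apply: eq_bigr => N _.
  have e (S : {set 'I_d}) : (inord #|S| == N) = (#|S| == N).
    rewrite -val_eqE /= inordK // ltnS; by have := max_card (mem S); rewrite card_ord.
  rewrite (eq_bigl _ _ e) (eq_bigr (fun _ => (d - N)`!%:R * skeletons N)); last by move=> S /eqP ->.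
  rewrite sumr_const -[X in _ *+ X]cardsE card_draws card_ord.
  have Nd : (N <= d)%N by rewrite -ltnS.
  rewrite -(bin_fact Nd) -mulr_natl !natrM.
  have := fact_gt0 N; move: (skeletons N) => z Ng.
  by field; rewrite pnatr_eq0 -lt0n.
rewrite -mulr_sumr; congr (_ * _).
have out1 N : (d < N)%N -> skeletons N = 0.
  move=> dN; apply: big1 => pi _; apply: big1 => s _; apply: big1 => k _; apply: big_pred0 => x.
  apply/negP => /andP[/forallP x0 /eqP xs]; move: dN; rewrite -xs ltnNge => /negP; apply.
  by rewrite -[X in (X <= _)%N]card_ord -sum1_card; apply: leq_sum => i _; apply: x0.
have out2 N : (2 * sumn w < N)%N -> skeletons N = 0.
  move=> wN; apply: big_pred0 => pi; apply/negP => /andP[fp /eqP sp].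
  by have := card_joint_supp fp; rewrite sp cardsT card_ord leqNgt wN.
pose B := (d.+1 + (2 * sumn w).+1)%N.
transitivity (\sum_(N < B) skeletons N / N`!%:R).
  rewrite (big_ord_widen B (fun N => skeletons N / N`!%:R)) ?leq_addr // big_mkcond.
  apply: eq_bigr => N _; case: ltnP => // h; by rewrite out1 ?mul0r.
rewrite [RHS](big_ord_widen B (fun N => skeletons N / N`!%:R)) ?leq_addl // [RHS]big_mkcond.
apply: eq_bigr => N _; case: ltnP => // h; by rewrite out2 ?mul0r.
Qed.

End Supports.

(** * Polynomiality on a chamber *)

Section ToMpoly.
Local Open Scope ring_scope.
Variables (m n : nat).
Let K := ('I_m + 'I_n)%type.

Lemma mpolyX_neq0 k (u : 'X_{1..k}) : 'X_[rat, u] != 0.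
Proof. by rewrite -msize_poly_eq0 msizeX. Qed.

(** Balanced vectors contain the parts of nu with a minus sign, which is undone here. *)
Definition signed_point (v : K -> int) (i : 'I_(m + n)) : rat :=
  match split i with inl a => (v (inl a))%:~R | inr c => - (v (inr c))%:~R end.

Lemma polyfun_mpoly D (f : (K -> int) -> rat) : polyfun D f ->
  exists P : {mpoly rat[m + n]}, (msize P <= D.+1)%N /\
    forall v, f v = P.@[signed_point v].
Proof.
elim=> [{}D c|{}D k {}f _ [P [sP eP]]|{}D {}f g _ [P [sP eP]] _ [Q [sQ eQ]]|{}D {}f g fg _ [P [sP eP]]].
- exists c%:MP; split=> [|v]; last by rewrite mevalC.
  by rewrite msizeC; case: (c != 0).
- pose sg : rat := if k is inl _ then 1 else -1.
  exists ((sg *: 'X_(unsplit k)) * P); split=> [|v].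
    have [->|nP] := eqVneq P 0; first by rewrite mulr0 msize0.
    have sg0 : sg != 0 by rewrite /sg; case: (k).
    rewrite msizeM // ?scaler_eq0 ?(negbTE sg0) ?mpolyX_neq0 //.
    by rewrite msizeZ // msizeX mdeg1; exact: sP.
  rewrite mevalM mevalZ mevalXU -eP /signed_point unsplitK; congr (_ * _).
  by rewrite /sg; case: (k) => a; rewrite ?mul1r // mulN1r opprK.
- exists (P + Q); split=> [|v]; last by rewrite mevalD eP eQ.
  by apply: leq_trans (msizeD_le _ _) _; rewrite geq_max sP sQ.
- by exists P; split=> // v; rewrite -fg.
Qed.

Definition pair_vec (mu : m.-tuple nat) (nu : n.-tuple nat) : K -> int :=
  fun v => match v with inl a => (tnth mu a)%:Z | inr c => - (tnth nu c)%:Z end.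

Lemma signed_point_pair mu nu i :
  signed_point (pair_vec mu nu) i = (tnth [tuple of mu ++ nu] i)%:R.
Proof.
rewrite /signed_point /pair_vec; case: split_ordP => j ->.
  by rewrite tnth_lshift.
by rewrite tnth_rshift mulrNz opprK.
Qed.

Lemma balanced_pair mu nu : tsum mu = tsum nu -> balanced (pair_vec mu nu).
Proof.
rewrite /balanced /tsum big_sumType /= sumrN => e.
by rewrite -!(big_morph Posz PoszD (erefl _)) e subrr.
Qed.

Lemma cut_pair (X : {set K}) mu nu :
  cut X (pair_vec mu nu) = (\sum_(i in [set i | inl i \in X]) tnth mu i)%N%:Z
    - (\sum_(j in [set j | inr j \in X]) tnth nu j)%N%:Z.
Proof.
rewrite /cut big_mkcond big_sumType /= !(big_morph Posz PoszD (erefl _)).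
rewrite -!big_mkcond /= sumrN; congr (_ - _); apply: eq_bigl => i; by rewrite inE.
Qed.

(* Adding a multiple of the form vanishing on balanced points adjusts the degree. *)
Lemma exact_degree (E : nat) (P : {mpoly rat[m + n]}) : (0 < m)%N -> (msize P <= E.+2)%N ->
  exists Q : {mpoly rat[m + n]}, msize Q = E.+2 /\
    forall v, balanced v -> Q.@[signed_point v] = P.@[signed_point v].
Proof.
move=> m0 sP; have [sE|nE] := eqVneq (msize P) E.+2; first by exists P.
have [L [sL eL]] := polyfun_mpoly (polyfun_cut [set: K]).
(* The form is not constant: it differs at 0 and at a unit vector. *)
have L0 : (1 < msize L)%N.
  rewrite ltnNge; apply/negP => /msize1_polyC LC.
  have := eL (fun _ => 0); have := eL (fun x => (x == inl (Ordinal m0))%:Z).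
  rewrite LC !mevalC => <-; rewrite /cut big1 // (bigD1 (inl (Ordinal m0))) ?inE //=.
  by rewrite big1 // => x /andP[_ /negbTE ->].
have sL2 : msize L = 2%N by lia.
pose M : {mpoly rat[m + n]} := 'X_[U_(lshift n (Ordinal m0)) *+ E].
have sLM : msize (L * M) = E.+2.
  rewrite msizeM ?sL2 ?mpolyX_neq0 //; last by apply: contraTneq L0 => ->; rewrite msize0.
  by rewrite msizeX mdegMn mdeg1 mul1n.
exists (P + L * M); split.
  have sPE : (msize P <= E.+1)%N by rewrite -ltnS ltn_neqAle nE.
  apply/eqP; rewrite eqn_leq; apply/andP; split.
    by apply: leq_trans (msizeD_le _ _) _; rewrite geq_max sLM sP leqnn.
  rewrite leqNgt; apply/negP => sD.
  have := msizeD_le (P + L * M) (- P); rewrite addrAC subrr add0r sLM msizeN leqNgt.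
  by rewrite gtn_max !ltnS sPE -ltnS sD.
move=> v bv; rewrite mevalD mevalM -eL.
suff -> : cut setT v = 0 by rewrite mul0r addr0.
by rewrite -[RHS]bv /cut; apply: eq_bigl => x; rewrite inE.
Qed.

End ToMpoly.

Section ChamberPolynomial.
Local Open Scope ring_scope.
Variables (m n : nat) (c : m.-tuple nat -> n.-tuple nat -> Prop).
Hypotheses (m0 : (0 < m)%N) (n0 : (0 < n)%N).
Variable side : {set 'I_m} -> {set 'I_n} -> bool.
Hypothesis cP : forall M N, c M N <->
  in_H M N /\ forall I J, is_wall_index I J -> on_side M N I J (side I J).
Let K := ('I_m + 'I_n)%type.
Let j0 := (Ordinal m0, Ordinal n0).

(** The pair of singletons {i}, {j} indexes a wall unless it is the full pair. *)
Lemma chamber_nowall mu nu : c mu nu -> forall i j, tnth mu i = tnth nu j -> m = 1%N /\ n = 1%N.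
Proof.
move=> /cP[_ h] i j e.
have [/eqP[/setP eI /setP eJ]|/eqP ne] := boolP (([set i], [set j]) == (setT, setT)).
  split.
    by rewrite -(card_ord m) -cardsT -(cards1 i); apply: eq_card => x; rewrite eI.
  by rewrite -(card_ord n) -cardsT -(cards1 j); apply: eq_card => x; rewrite eJ.
have : is_wall_index [set i] [set j].
  by split=> // -[/setP/(_ i)]; rewrite !inE eqxx.
by move/h; rewrite /on_side !big_set1 e ltnn; case: (side _ _).
Qed.

(** The marked point i becomes an edge from its cycle in sigma_1 to its cycle in the product with
    the transpositions, and carries the flow x i. *)
Lemma arc_flow d N (k : {ffun 'I_N -> 'I_m * 'I_n}) (x : {ffun 'I_N -> 'I_d.+1}) mu nu :
  tsum mu = d ->
  (arcs d x && (margins mu nu (arc_content k x) != 0)) =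
  is_flow (fun i => inl (k i).1 : K) (fun i => inr (k i).2) (pair_vec mu nu) x.
Proof.
move=> ed; rewrite /margins pnatr_eq0 eqb0 negbK /is_flow /arcs.
have c1 a : (\sum_b arc_content k x (a, b) = \sum_(i | (k i).1 == a) x i)%N.
  rewrite (partition_big (fun i => (k i).2) predT) //=; apply: eq_bigr => b _; rewrite ffunE.
  by apply: eq_bigl => i; case: (k i) => u v; rewrite xpair_eqE.
have c2 b : (\sum_a arc_content k x (a, b) = \sum_(i | (k i).2 == b) x i)%N.
  rewrite (partition_big (fun i => (k i).1) predT) //=; apply: eq_bigr => a _; rewrite ffunE.
  by apply: eq_bigl => i; case: (k i) => u v; rewrite xpair_eqE andbC.
have f1 a : \sum_i (x i : nat)%:Z * edge (inl (k i).1 : K) (inr (k i).2) (inl a)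
    = (\sum_(i | (k i).1 == a) x i)%N%:Z.
  rewrite (big_morph Posz PoszD (erefl _)) [RHS]big_mkcond; apply: eq_bigr => i _.
  by rewrite /edge subr0 eq_sym; case: eqP => [[->]|ne];
     rewrite ?eqxx ?mulr1 // mulr0; case: eqP => // e; rewrite e in ne.
have f2 b : \sum_i (x i : nat)%:Z * edge (inl (k i).1 : K) (inr (k i).2) (inr b)
    = - (\sum_(i | (k i).2 == b) x i)%N%:Z.
  rewrite (big_morph Posz PoszD (erefl _)) [X in _ = - X]big_mkcond -sumrN; apply: eq_bigr => i _.
  by rewrite /edge sub0r mulrN eq_sym; case: eqP => [[->]|ne];
     rewrite ?eqxx ?mulr1 // mulr0 oppr0; case: eqP => // e; rewrite e in ne.
apply/andP/andP => [[/andP[h1 h2] /andP[/forallP h3 /forallP h4]]|[h1 /forallP h2]].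
  split=> //; apply/forallP => -[a|b]; rewrite /pair_vec.
    by rewrite f1 -c1 (eqP (h3 a)).
  by rewrite f2 -c2 (eqP (h4 b)).
have h3 a : (\sum_(i | (k i).1 == a) x i = tnth mu a)%N.
  by have := h2 (inl a); rewrite /pair_vec f1 => /eqP[].
have h4 b : (\sum_(i | (k i).2 == b) x i = tnth nu b)%N.
  by have := h2 (inr b); rewrite /pair_vec f2 => /eqP /oppr_inj [].
split; apply/andP; split=> //.
- rewrite (partition_big (fun i => (k i).1) predT) //=; apply/eqP; apply: (etrans _ ed).
  by apply: eq_bigr => a _; apply: h3.
- by apply/forallP => a; rewrite c1 h3.
- by apply/forallP => b; rewrite c2 h4.
Qed.

Lemma arc_sum_poly N (k : {ffun 'I_N -> 'I_m * 'I_n}) :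
  exists f : (K -> int) -> rat, polyfun (N - (m + n).-1) f /\
  forall mu nu, c mu nu -> arc_sum (tsum mu) (tsum mu) k (margins mu nu) = f (pair_vec mu nu).
Proof.
pose src : {set K} := [set v | if v is inl _ then true else false].
pose k0 : K := inl (Ordinal m0).
pose sd (X : {set K}) := side [set i | inl i \in X] [set j | inr j \in X].
have [|f pf hf] := flow_count_chamber (star_basis k0) (eu := fun i => inl (k i).1)
   (ew := fun i => inr (k i).2) (src := src) sd.
  by move=> i; rewrite !inE.
have cF : #|{: {v : K | v != k0}}| = (m + n).-1.
  by rewrite card_sig (cardC1 k0) card_sum !card_ord.
exists f; split; first by rewrite -cF.
move=> mu nu /cP[[_ _ mn] hs]; rewrite -(hf (pair_vec mu nu) _ _ (tsum mu)).
- rewrite /arc_sum big_mkcond [RHS]big_mkcond; apply: eq_bigr => x _; rewrite -arc_flow //.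
  by case: (arcs _ _) => //=; rewrite /margins; case: (_ && _).
- exact: balanced_pair.
- move=> X X0 XT; rewrite cut_pair subr_gt0 subr_lt0 /sd.
  have wI : is_wall_index [set i | inl i \in X] [set j | inr j \in X].
    split=> -[/setP eI /setP eJ].
      case/eqP: X0; apply/setP => -[a|b]; rewrite inE.
        by have := eI a; rewrite !inE.
      by have := eJ b; rewrite !inE.
    case/eqP: XT; apply/setP => -[a|b]; rewrite inE.
      by have := eI a; rewrite !inE.
    by have := eJ b; rewrite !inE.
  by have := hs _ _ wI; rewrite /on_side; case: (side _ _).
- rewrite cut_pair (_ : (\sum_(j in [set j | inr j \in src]) tnth nu j)%N = 0%N); last first.
    by apply: big_pred0 => j; rewrite !inE.
  rewrite subr0 /tsum.
  by rewrite lez_nat big_mkcond; apply: leq_sum => i _; case: ifP.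
Qed.

Lemma polyfun_bigsum (I : finType) (P : pred I) D (h : I -> (K -> int) -> rat) :
  (forall i, polyfun D (h i)) -> polyfun D (fun b => \sum_(i | P i) h i b).
Proof.
move=> hh; apply: (@polyfun_ext _ _ (fun b => \sum_(i <- filter P (enum I)) h i b)).
  by move=> b; rewrite big_filter big_enum_cond.
by apply: polyfun_sum.
Qed.

Lemma skeletons_poly w N : exists f : (K -> int) -> rat, polyfun (N - (m + n).-1) f /\
  forall mu nu, c mu nu -> skeletons w mu nu j0 (tsum mu) N = f (pair_vec mu nu).
Proof.
have [f hf] := fin_all_exists (@arc_sum_poly N).
exists (fun b => \sum_(pi : {ffun 'I_(size w) -> 'S_N} | factors pi && (joint_supp pi == setT))
  \sum_(s : 'S_N) \sum_(k | labelling setT (\prod_j pi j)%g j0 setT s k) f k b); split.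
  apply: polyfun_bigsum => pi; apply: polyfun_bigsum => s; apply: polyfun_bigsum => k.
  by case: (hf k).
move=> mu nu cmn; apply: eq_bigr => pi _; apply: eq_bigr => s _; apply: eq_bigr => k _.
by case: (hf k) => _ ->.
Qed.

Lemma tsum_gt0 mu nu : c mu nu -> (0 < tsum mu)%N.
Proof.
move=> /cP[[mu0 _ _] _]; rewrite /tsum (bigD1 (Ordinal m0)) //=.
by rewrite addn_gt0 mu0.
Qed.

Lemma hurwitz_poly p q r : (0 < p + q + r)%N ->
  exists f : (K -> int) -> rat, polyfun (2 * (p + q + r) - (m + n).-1) f /\
  forall mu nu, c mu nu -> triply_mixed_hurwitz p q r mu nu = f (pair_vec mu nu).
Proof.
move=> b0; have [L [Lp LE]] := mixed_sum_elems p q r.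
have [f hf] := fin_all_exists (fun i : 'I_(size L) =>
  fin_all_exists (fun N : 'I_(2 * (p + q + r)).+1 => skeletons_poly (nth (0, [::]) L i).2 N)).
exists (fun b => \sum_(i < size L) (nth (0, [::]) L i).1 *
   \sum_(N < (2 * (p + q + r)).+1) N`!%:R^-1 * f i N b); split.
  apply: polyfun_bigsum => i; apply: polyfun_scale; apply: polyfun_bigsum => N; apply: polyfun_scale.
  by apply: polyfun_weaken (hf i N).1; have := ltn_ord N; lia.
move=> mu nu cmn; rewrite /triply_mixed_hurwitz (@card_mixed_factorisations _ _ _ mu nu j0) LE.
rewrite (big_nth (0, [::])) big_mkord mulr_suml; apply: eq_bigr => i _.
have /andP[/eqP sw pw] := allP Lp _ (mem_nth (0, [::]) (ltn_ord i)).
have d0 := tsum_gt0 cmn.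
have b1 : (0 < sumn (nth (0%R, [::]) L i).2)%N by rewrite sw.
rewrite elems_weight //; [|by move: b1; case: (nth _ _ _).2|exact: chamber_nowall cmn].
(* The factor d! cancels against the normalisation of the Hurwitz number. *)
rewrite sw -!mulrA; congr (_ * _); rewrite mulrC -mulrA mulVf ?mulr1; last first.
  by rewrite pnatr_eq0 -lt0n fact_gt0.
apply: eq_bigr => N _; rewrite mulrC; congr (_ * _).
by have [_ ->] := hf i N.
Qed.

End ChamberPolynomial.

(** * Nonvanishing in degree 0 *)

Section OneTransposition.
Local Open Scope ring_scope.

Lemma margins_ge0 m n (mu : m.-tuple nat) (nu : n.-tuple nat) z : 0 <= margins mu nu z.
Proof. exact: ler0n. Qed.

Lemma skeleton_sum_ge0 N D m n g j0 t (mu : m.-tuple nat) (nu : n.-tuple nat) :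
  0 <= @skeleton_sum N D m n g j0 t (margins mu nu).
Proof.
apply: sumr_ge0 => s _; apply: sumr_ge0 => k _; apply: sumr_ge0 => x _; exact: margins_ge0.
Qed.

Lemma skeletons_ge0 w m n (mu : m.-tuple nat) (nu : n.-tuple nat) j0 d N :
  0 <= skeletons w mu nu j0 d N.
Proof. by apply: sumr_ge0 => pi _; apply: skeleton_sum_ge0. Qed.

Let t : 'S_2 := tperm ord0 ord_max.

Lemma ncycles_tperm2 : ncycles t = 1%N.
Proof.
have h0 : (ord0 : 'I_2) \notin [set ord_max] by rewrite inE.
have h1 : (ord_max : 'I_2) \in [set ord_max] by rewrite inE.
by have := ncycles_tperm (perm_on1 _) h0 h1; rewrite ncycles1 card_ord mulg1 => -[].
Qed.

(** All summands are nonnegative, so one positive summand suffices. *)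
Lemma skeletons1_gt0 m n (mu : m.-tuple nat) (nu : n.-tuple nat) j0 d s k
    (x : {ffun 'I_2 -> 'I_d.+1}) :
  labelling setT t j0 setT s k -> arcs d x -> margins mu nu (arc_content k x) != 0 ->
  0 < skeletons [:: 1%N] mu nu j0 d 2.
Proof.
move=> hk hx hm; pose pi : {ffun 'I_1 -> 'S_2} := [ffun _ => t].
rewrite /skeletons (bigD1 pi) /=; last first.
  apply/andP; split.
    by apply/forallP => j; rewrite ffunE ncycles_tperm2 (ord1 j).
  apply/eqP/setP => y; rewrite !inE; apply/existsP; exists ord0; rewrite ffunE /t.
  by case: tpermP => [->|->|/eqP y0 /eqP y1] //; move: y0 y1; rewrite -!val_eqE; case: y => -[|[|]].
apply: ltr_wpDr; first by apply: sumr_ge0 => ? _; apply: skeleton_sum_ge0.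
rewrite big_ord1 ffunE /skeleton_sum (bigD1 s) //=; apply: ltr_wpDr.
  by apply: sumr_ge0 => s' _; apply: sumr_ge0 => k' _; apply: sumr_ge0 => x' _; apply: margins_ge0.
rewrite (bigD1 k) //=; apply: ltr_wpDr.
  by apply: sumr_ge0 => k' _; apply: sumr_ge0 => x' _; apply: margins_ge0.
rewrite /arc_sum (bigD1 x) //=; apply: ltr_wpDr; first by apply: sumr_ge0 => x' _; apply: margins_ge0.
by rewrite lt0r hm margins_ge0.
Qed.

Lemma skeletons12_gt0 (mu : 1.-tuple nat) (nu : 2.-tuple nat) j0 :
  in_H mu nu -> 0 < skeletons [:: 1%N] mu nu j0 (tsum mu) 2.
Proof.
case=> _ nu0 e; pose x : {ffun 'I_2 -> 'I_(tsum mu).+1} := [ffun j => inord (tnth nu j)].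
have xE j : x j = tnth nu j :> nat.
  by rewrite ffunE inordK // ltnS e /tsum (bigD1 j) //= leq_addr.
have h1 (a : 'I_1) : a == ord0 by rewrite (ord1 a).
have tt : (t * t = 1)%g by rewrite -[X in (_ * X)%g]tpermV mulgV.
(* A 2-cycle on the marked points, which [t] cuts into two fixed points with the parts of nu as
   return times. *)
apply: (@skeletons1_gt0 _ _ _ _ _ _ t [ffun j => (ord0, j)] x).
- apply/and5P; split; try apply/and3P; try split;
  rewrite ?tt ?cardsT ?card_ord ?ncycles_tperm2 ?ncycles1 ?card_ord //.
  + by apply/forallP => y; rewrite !ffunE.
  + by apply/forallP => y; rewrite perm1.
  + by apply/forallP => y; rewrite inE.
  + by apply/forallP => y; apply/existsP; exists ord0; rewrite inE ffunE eq_sym h1.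
  + by apply/forallP => y; apply/existsP; exists y; rewrite inE ffunE /=.
- apply/andP; split; first by apply/forallP => j; rewrite xE.
  by rewrite (eq_bigr (fun j => tnth nu j)) // -/(tsum nu) e.
have cE j : arc_content [ffun j => (ord0 : 'I_1, j)] x (ord0, j) = tnth nu j.
  rewrite ffunE (big_pred1 j) ?xE // => j'; by rewrite /= ffunE xpair_eqE eqxx.
rewrite /margins pnatr_eq0 eqb0 negbK; apply/andP; split; apply/forallP => i.
  rewrite (ord1 i) (eq_bigr _ (fun j _ => cE j)) -/(tsum nu) -e /tsum big_ord1 //.
by rewrite big_ord1 cE.
Qed.

Lemma skeletons21_gt0 (mu : 2.-tuple nat) (nu : 1.-tuple nat) j0 :
  in_H mu nu -> 0 < skeletons [:: 1%N] mu nu j0 (tsum mu) 2.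
Proof.
case=> mu0 _ e; pose x : {ffun 'I_2 -> 'I_(tsum mu).+1} := [ffun j => inord (tnth mu j)].
have xE j : x j = tnth mu j :> nat.
  by rewrite ffunE inordK // ltnS /tsum (bigD1 j) //= leq_addr.
have h1 (a : 'I_1) : a == ord0 by rewrite (ord1 a).
(* Two fixed marked points with the parts of mu as return times, joined by [t]. *)
apply: (@skeletons1_gt0 _ _ _ _ _ _ 1%g [ffun j => (j, ord0)] x).
- apply/and5P; split; try apply/and3P; try split;
  rewrite ?mul1g ?cardsT ?card_ord ?ncycles_tperm2 ?ncycles1 ?card_ord //.
  + by apply/forallP => y; rewrite perm1.
  + by apply/forallP => y; rewrite !ffunE.
  + by apply/forallP => y; rewrite inE.
  + by apply/forallP => y; apply/existsP; exists y; rewrite inE ffunE /=.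
  + by apply/forallP => y; apply/existsP; exists ord0; rewrite inE ffunE eq_sym h1.
- apply/andP; split; first by apply/forallP => j; rewrite xE.
  by rewrite (eq_bigr (fun j => tnth mu j)).
have cE j : arc_content [ffun j => (j, ord0 : 'I_1)] x (j, ord0) = tnth mu j.
  rewrite ffunE (big_pred1 j) ?xE // => j'; by rewrite /= ffunE xpair_eqE eqxx andbT.
rewrite /margins pnatr_eq0 eqb0 negbK; apply/andP; split; apply/forallP => i.
  by rewrite big_ord1 cE.
by rewrite (ord1 i) (eq_bigr _ (fun j _ => cE j)) -/(tsum mu) e /tsum big_ord1.
Qed.

Lemma hurwitz_single_neq0 p q r m n (mu : m.-tuple nat) (nu : n.-tuple nat) :
  (0 < m)%N -> (0 < n)%N -> (p + q + r = 1)%N -> (m + n = 3)%N -> in_H mu nu ->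
  (forall i j, tnth mu i = tnth nu j -> m = 1%N /\ n = 1%N) ->
  triply_mixed_hurwitz p q r mu nu != 0.
Proof.
move=> m0 n0 b1 mn hH nw; pose j0 := (Ordinal m0, Ordinal n0).
have d0 : (0 < tsum mu)%N.
  by case: hH => mu0 _ _; rewrite /tsum (bigD1 (Ordinal m0)) //= addn_gt0 mu0.
rewrite /triply_mixed_hurwitz (@card_mixed_factorisations _ _ _ mu nu j0) mixed_sum_single //.
rewrite elems_weight // mulf_neq0 ?invr_eq0 ?pnatr_eq0 -?lt0n ?fact_gt0 // mulf_neq0 //.
  by rewrite pnatr_eq0 -lt0n fact_gt0.
rewrite gt_eqF // (bigD1 (Ordinal (isT : (2 < (2 * sumn [:: 1]).+1)%N))) //=.
apply: ltr_wpDr.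
  by apply: sumr_ge0 => N _; rewrite divr_ge0 ?ler0n // skeletons_ge0.
apply: divr_gt0; last by rewrite ltr0n.
have [e|e] : (m = 1 /\ n = 2 \/ m = 2 /\ n = 1)%N by lia.
  case: e => em en; subst m n; exact: skeletons12_gt0.
case: e => em en; subst m n; exact: skeletons21_gt0.
Qed.

End OneTransposition.

Theorem theorem4p4 (p q r m n g : nat)
    (c : m.-tuple nat -> n.-tuple nat -> Prop) :
  0 < m -> 0 < n ->
  p + q + r = 2 * g + m + n - 2 ->
  (g, n + m) <> (0, 2) ->
  is_chamber c ->
  exists P : {mpoly rat[m + n]},
    msize P = (4 * g + m + n - 3).+1 /\
    forall (mu : m.-tuple nat) (nu : n.-tuple nat), c mu nu ->
      triply_mixed_hurwitz p q r mu nu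
      = P.@[fun i => (tnth [tuple of mu ++ nu] i)%:R%R]%R.
Proof.
move=> m0 n0 eb gmn [[M0 [N0 c0]] [side cP]].
have b0 : 0 < p + q + r.
  rewrite eb; case: (posnP g) => [g0|]; last by lia.
  case: (ltnP 2 (n + m)) => mn; first by lia.
  by case: gmn; rewrite g0; congr pair; lia.
have [f [pf hf]] := hurwitz_poly m0 n0 cP b0.
(* Here 2 (2g + m + n - 2) - (m + n - 1) = 4g + m + n - 3. *)
have {}pf : polyfun (4 * g + m + n - 3) f by apply: polyfun_weaken pf; lia.
have [P [sP eP]] := polyfun_mpoly pf.
have bal mu nu : c mu nu -> balanced (pair_vec mu nu).
  by move=> /cP[[_ _ e] _]; apply: balanced_pair.
have pt (mu : m.-tuple nat) (nu : n.-tuple nat) (Q : {mpoly rat[m + n]}) :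
    (Q.@[fun i => (tnth [tuple of mu ++ nu] i)%:R] = Q.@[signed_point (pair_vec mu nu)])%R.
  by apply: meval_eq => i; rewrite signed_point_pair.
(* In degree 0 one has g = 0, m + n = 3 and b = 1, and the constant is tested at the given point of
   the chamber. *)
case eE: (4 * g + m + n - 3) sP => [|E] sP.
  exists P; split; last by move=> mu nu cmn; rewrite pt -eP hf.
  apply/eqP; rewrite eqn_leq sP lt0n msize_poly_eq0; apply/eqP => P0.
  have : triply_mixed_hurwitz p q r M0 N0 != 0%R.
    apply: hurwitz_single_neq0 => //; [lia|lia|by have /cP[] := c0|].
    exact: chamber_nowall cP _ _ c0.
  by rewrite (hf _ _ c0) eP P0 meval0 eqxx.
have [Q [sQ eQ]] := exact_degree m0 sP.
exists Q; split=> // mu nu cmn.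
by rewrite pt (eQ _ (bal _ _ cmn)) -eP hf.
Qed.
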